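(* Let $A = K[x_1, \ldots, x_n]$ denote the polynomial ring in $n$ variables over a field $K$ of characteristic $0$ with each $\deg x_i = 1$. Given arbitrary integers $i$ and $j$ with $2 \leq i \leq n$ and $3 \leq j \leq n$, there exists a monomial ideal $I \subset A$ such that (i) $\beta_k(I) < \beta_k(\mathrm{Gin}(I))$ for all $k < i$ (where $k \ge 0$); (ii) $\beta_i(I) = \beta_i(\mathrm{Gin}(I))$; (iii) $\beta_\ell(\mathrm{Gin}(I)) < \beta_\ell(\mathrm{Lex}(I))$ for all $\ell < j$ (where $\ell \ge 0$); (iv) $\beta_j(\mathrm{Gin}(I)) = \beta_j(\mathrm{Lex}(I))$.
   Context: For a homogeneous ideal $I \subset A$ and an integer $k \geq 0$, $\beta_k(I) = \dim_K \mathrm{Tor}^A_k(K, I)$ denotes the $k$th Betti number of $I$ (the ideal itself, not $A/I$) over $A$, where $K = A/(x_1,\ldots,x_n)$. $\mathrm{Gin}(I)$ is the generic initial ideal of $I$ with respect to the (degree) reverse lexicographic order $<_{\mathrm{rev}}$ induced by $x_1 > \cdots > x_n$, i.e. the initial ideal $\mathrm{in}_{<_{\mathrm{rev}}}(\varphi(I))$, which is the same for all $\varphi$ in some nonempty Zariski open subset of $\mathrm{GL}(n;K)$ acting on $A$ by linear changes of variables. $\mathrm{Lex}(I)$ is the lexsegment ideal with the same Hilbert function as $I$: the monomial ideal whose degree $d$ component is, for each $d$, spanned by the $\dim_K I_d$ largest monomials of degree $d$ with respect to the lexicographic order $<_{\mathrm{lex}}$ induced by $x_1 > \cdots > x_n$.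 *)

(* Defs.v *)
From mathcomp Require Import all_boot all_order all_algebra.
From mathcomp Require Import boolp classical_sets.
From mathcomp Require Import mpoly.

Set Implicit Arguments.
Unset Strict Implicit.
Unset Printing Implicit Defensive.

Import Order.TTheory GRing.Theory.
Local Open Scope classical_set_scope.
Local Open Scope ring_scope.

(* Dimension of a finite-dimensional K-subspace S of V: the length of any
   basis of S (0 by convention if S has no finite basis). *)
Definition is_basis (K : fieldType) (V : lmodType K) (S : set V) (r : nat)
    (b : 'I_r -> V) : Prop :=
  (forall v, S v <-> exists c : 'I_r -> K, v = \sum_i c i *: b i) /\
  (forall c : 'I_r -> K, \sum_i c i *: b i = 0 -> forall i, c i = 0).

Definition dim_set (K : fieldType) (V : lmodType K) (S : set V) : nat :=
  xget 0%N [set r | exists b : 'I_r -> V, is_basis S b].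

Section Ideals.
Variables (n : nat) (K : fieldType).

(* Ideals of A are Prop-valued subsets; the variables x_1, ..., x_n are
   'X_i for i : 'I_n, so x_1 has index 0. *)
Local Notation A := {mpoly K[n]}.

Definition ideal_gen (G : set A) : set A :=
  [set f | exists (r : nat) (c g : 'I_r -> A),
             (forall i, G (g i)) /\ f = \sum_i c i * g i].

Definition monomial_ideal (I : set A) : Prop :=
  exists M : set 'X_{1..n}, I = ideal_gen [set 'X_[m] | m in M].

(* Free resolutions of I by finitely generated free A-modules
     ... -> A^(rk 2) -> A^(rk 1) -> A^(rk 0) -> I -> 0.
   The elements of A^r are row vectors, and matrices act on the right. *)
Record free_resolution (I : set A) := FreeResolution {
  fr_rk : nat -> nat;
  fr_d : forall k, 'M[A]_(fr_rk k.+1, fr_rk k);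
  fr_aug : 'cV[A]_(fr_rk 0);
  fr_aug_image : forall f : A,
    I f <-> exists v : 'rV[A]_(fr_rk 0), v *m fr_aug = f%:M;
  fr_exact0 : forall v : 'rV[A]_(fr_rk 0),
    v *m fr_aug = 0 <-> exists w, v = w *m fr_d 0;
  fr_exact : forall k (v : 'rV[A]_(fr_rk k.+1)),
    v *m fr_d k = 0 <-> exists w, v = w *m fr_d k.+1 }.

(* The differential of the tensor product of F with K = A / (x_1, ..., x_n):
   the quotient map A -> K sends f to its constant coefficient. *)
Definition fr_dbar (I : set A) (F : free_resolution I) (k : nat) :
    'M[K]_(fr_rk F k.+1, fr_rk F k) :=
  map_mx (fun f : A => f@_(0%MM)) (fr_d F k).

(* The dimension of the k-th homology of the tensor product of F with K:
   dim (cycles) - dim (boundaries), the latter never being the larger. *)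
Definition tor_dim (I : set A) (F : free_resolution I) (k : nat) : nat :=
  (match k with
   | 0 => fr_rk F 0
   | k'.+1 => \rank (kermx (fr_dbar F k'))
   end - \rank (fr_dbar F k))%N.

(* dim_K Tor^A_k(K, I): the homology does not depend on the resolution, and a
   resolution F exists for every ideal because A is noetherian. *)
Definition betti (I : set A) (k : nat) : nat :=
  xget 0%N [set b | exists F : free_resolution I, b = tor_dim F k].

(* Among monomials of the same degree, m1 < m2 iff the last nonzero entry of
   the exponent vector of m2 - m1 is negative. *)
Definition revlex_lt (m1 m2 : 'X_{1..n}) : bool :=
  (mdeg m1 < mdeg m2)%N ||
  (mdeg m1 == mdeg m2) &&
  [exists k : 'I_n, (m2 k < m1 k)%N &&
     [forall l : 'I_n, (k < l)%N ==> (m1 l == m2 l)]].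

Definition revlex_lead (f : A) (m : 'X_{1..n}) : Prop :=
  m \in msupp f /\
  forall m', m' \in msupp f -> m' != m -> revlex_lt m' m.

Definition initial_ideal (J : set A) : set A :=
  ideal_gen [set 'X_[m] | m in [set m | exists2 f, J f & revlex_lead f m]].

(* The change of variables x_j |-> \sum_i g_ij x_i. *)
Definition lin_subst (g : 'M[K]_n) (f : A) : A :=
  f \mPo [tuple \sum_i g i j *: 'X_i | j < n].

(* Open subsets of GL(n; K) for the Zariski topology induced by the affine
   space of n x n matrices, whose n * n coordinates are the entries. *)
Definition zariski_openGL (U : set 'M[K]_n) : Prop :=
  exists P : set {mpoly K[n * n]},
    U = [set g | g \in unitmx /\
                 exists2 p, P p & p.@[fun k => mxvec g 0 k] != 0].

Definition is_gin (I J : set A) : Prop :=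
  exists U : set 'M[K]_n,
    [/\ zariski_openGL U, U !=set0 &
        forall g, U g -> initial_ideal (lin_subst g @` I) = J].

(* For K infinite and I a homogeneous ideal there is exactly one J with
   is_gin I J. *)
Definition Gin (I : set A) : set A := xget set0 [set J | is_gin I J].

Definition hilb (I : set A) (d : nat) : nat :=
  dim_set [set f : A | I f /\ f \is d.-homog].

(* On monomials of equal degree, the order of the library is the lexicographic
   order with x_1 > ... > x_n. Hence m is among the r largest monomials of its
   degree iff fewer than r monomials of that degree are greater than m. *)
Definition lex_mon (I : set A) : set 'X_{1..n} :=
  [set m | (#|[pred u : 'X_{1..n < (mdeg m).+1} |
                 (mdeg u == mdeg m) && (m < bmnm u)%O]|
            < hilb I (mdeg m))%N].

(* The K-span of lex_mon I. *)
Definition Lex (I : set A) : set A :=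
  [set f | forall m, m \in msupp f -> lex_mon I m].

End Ideals.

(* Main.v *)
Require Import Defs.
From mathcomp Require Import all_boot all_order all_algebra perm.
From mathcomp Require Import boolp classical_sets.
From mathcomp Require Import mpoly.
From mathcomp Require Import zify ring.

(** Put
      I = x_1^2 ((x_1, ..., x_(i-2)) m + (x_(i-1)^2, x_i^2)) + U + m^6,
    where U is spanned by x_1^2 A_3, the x_1 x_2^3 x_p with p < j, and x_2^5.
    Passing to Gin(I) only replaces x_1^2 x_i^2 by x_1^2 x_(i-1) x_i, because a
    generic substitution is a product of a lower and an upper triangular one: the
    former preserves leading monomials, the latter preserves the span of a set of
    monomials closed under the dominance order.  Passing from Gin(I) to Lex(I) only
    replaces x_2^5 by x_1 x_2^3 x_j.  Each of the three ideals is built by adding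
    one generator u at a time, in nondecreasing degree, to an ideal P for which
    P : u is generated by variables (and, once, by variables and a square).  Such
    mapping cones are minimal for degree reasons, so each step adds 'C(q, k) to the
    k-th Betti number, q being the number of generators of P : u.  The totals give
      beta_k(Gin I) = beta_k(I) + 'C(i - 1, k),
      beta_k(Lex I) = beta_k(Gin I) + 'C(j - 1, k) + \sum_(2 <= q < j - 1) 'C(q, k). *)

Set Implicit Arguments.
Unset Strict Implicit.
Unset Printing Implicit Defensive.

Import Order.TTheory GRing.Theory.
Local Open Scope ring_scope.

(** * Minimal free resolutions and Betti numbers *)

(** The two exchanges are kept apart by degree: the first happens in degree 4, the second in degree
    5. Having all of x_1^2 A_3 in degree 5 puts every proper multiple of x_1^2 x_i^2 and of x_1^2
    x_(i-1) x_i into both I and Gin(I), and m^6 does the same for the second pair, so each exchange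
    changes one monomial of one degree. The new monomials are the last ones of lexsegments: x_1^2
    x_(i-1) x_i in degree 4 and x_1 x_2^3 x_j in degree 5. The bound j >= 3 puts x_1 x_2^4 into U;
    without it x_2^5 would break closure under dominance. The first gap appears because Gin(I) needs
    one more quintic generator than I: the quadratic generator x_(i-1)^2 of the colon ideal of x_1^2
    x_i^2 is a syzygy that saves it. The second gap comes from the colon ideals of x_2^5 and x_1
    x_2^3 x_j, generated by 1 and by j - 1 variables. Characteristic 0 enters twice: nonempty
    Zariski open sets meet, and the cross term 2 x_(i-1) x_i of a square survives. *)

Lemma dependent_choice_fam (T : nat -> Type) (Q : forall k, T k -> Prop)
    (R : forall k, T k -> T k.+1 -> Prop) (x0 : T 0%N) :
    Q 0%N x0 ->
    (forall k x, Q k x -> exists y, R k x y /\ Q k.+1 y) ->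
  exists f : forall k, T k,
    f 0%N = x0 /\ forall k, Q k (f k) /\ R k (f k) (f k.+1).
Proof.
move=> Q0 step.
pose nxt k (s : {x : T k | Q k x}) :=
  cid (step k (sval s) (svalP s)).
pose g := fix g k : {x : T k | Q k x} :=
  match k with
  | 0%N => exist _ x0 Q0
  | k'.+1 => exist _ (sval (nxt k' (g k'))) (svalP (nxt k' (g k'))).2
  end.
exists (fun k => sval (g k)); split=> // k; split; first exact: svalP.
exact: (svalP (nxt k (g k))).1.
Qed.

Lemma mx_lift_rows (R : pzRingType) (p r s : nat) (d : 'M[R]_(r, s))
    (ok : 'I_p -> 'rV[R]_r -> Prop) (M : 'M[R]_(p, s)) :
    (forall i, exists w, ok i w /\ row i M = w *m d) ->
  exists X : 'M[R]_(p, r), (forall i, ok i (row i X)) /\ X *m d = M.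
Proof.
move=> /choice[w wP]; exists (\matrix_i w i); split=> [i|].
  by rewrite rowK; case: (wP i).
apply/row_matrixP => i; rewrite row_mul rowK.
by case: (wP i) => _ ->.
Qed.

(** The map [f] induces an injection of [ZA / dA] into [ZB / dB]; both quotient dimensions are read
    off as ranks after composing with the cokernel of [dB]. *)
Lemma rank_homology_le (K : fieldType) (a b a1 b1 : nat)
    (ZA : 'M[K]_a) (ZB : 'M[K]_b)
    (dA : 'M[K]_(a1, a)) (dB : 'M[K]_(b1, b)) (f : 'M[K]_(a, b)) :
    (dA <= ZA)%MS -> (dB <= ZB)%MS -> (ZA *m f <= ZB)%MS ->
    (forall z : 'rV[K]_a, (z <= ZA)%MS -> (z *m f <= dB)%MS -> (z <= dA)%MS) ->
  (\rank ZA - \rank dA <= \rank ZB - \rank dB)%N.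
Proof.
move=> dAZ dBZ fZ inj.
have cok m (w : 'M[K]_(m, b)) : (w *m cokermx dB == 0) = (w <= dB)%MS.
  by rewrite submxE.
have kerA : (ZA :&: kermx (f *m cokermx dB) <= dA)%MS.
  apply/rV_subP => z; rewrite sub_capmx => /andP[zZ /sub_kermxP zk].
  by apply: inj => //; rewrite -cok -mulmxA zk.
have EA := mxrank_mul_ker ZA (f *m cokermx dB).
have EB := mxrank_mul_ker ZB (cokermx dB).
have kerB : \rank (ZB :&: kermx (cokermx dB)) = \rank dB.
  apply/eqP; rewrite eqn_leq; apply/andP; split; apply: mxrankS.
    apply/rV_subP => z; rewrite sub_capmx => /andP[_ /sub_kermxP zk].
    by rewrite -cok zk.
  by rewrite sub_capmx dBZ; apply/sub_kermxP/eqP; rewrite cok.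
have le1 : (\rank (ZA *m (f *m cokermx dB)) <= \rank (ZB *m cokermx dB))%N.
  by rewrite mulmxA; apply: mxrankS; apply: submxMr.
have le2 := mxrankS kerA.
rewrite -{1}EA -{1}EB kerB addnK.
apply: leq_trans le1.
by rewrite leq_subLR addnC leq_add2r.
Qed.

(** * Independence of Tor from the chosen resolution *)

Section Comparison.
Variables (n : nat) (K : fieldType).
Local Notation A := {mpoly K[n]}.
Implicit Types I : set A.

Lemma fr_d_aug I (F : free_resolution I) : fr_d F 0 *m fr_aug F = 0.
Proof.
apply/row_matrixP => i; rewrite row_mul row0.
by apply/fr_exact0; exists (delta_mx 0 i); rewrite -rowE.
Qed.

Lemma fr_d_d I (F : free_resolution I) k : fr_d F k.+1 *m fr_d F k = 0.
Proof.
apply/row_matrixP => i; rewrite row_mul row0.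
by apply/fr_exact; exists (delta_mx 0 i); rewrite -rowE.
Qed.

Lemma fr_lift0 I (F : free_resolution I) p (M : 'M_(p, fr_rk F 0)) :
  M *m fr_aug F = 0 -> exists X, X *m fr_d F 0 = M.
Proof.
move=> M0; have [i|X [_ XE]] :=
    @mx_lift_rows _ p _ _ (fr_d F 0) (fun _ _ => True) M; last by exists X.
have /fr_exact0[w ->] : row i M *m fr_aug F = 0 by rewrite -row_mul M0 row0.
by exists w.
Qed.

Lemma fr_lift I (F : free_resolution I) p k (M : 'M_(p, fr_rk F k.+1)) :
  M *m fr_d F k = 0 -> exists X, X *m fr_d F k.+1 = M.
Proof.
move=> M0; have [i|X [_ XE]] :=
    @mx_lift_rows _ p _ _ (fr_d F k.+1) (fun _ _ => True) M; last by exists X.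
have /fr_exact[w ->] : row i M *m fr_d F k = 0 by rewrite -row_mul M0 row0.
by exists w.
Qed.

Lemma fr_chain_map I (F G : free_resolution I) :
  exists f : forall k, 'M[A]_(fr_rk F k, fr_rk G k),
    f 0%N *m fr_aug G = fr_aug F /\
    forall k, fr_d F k *m f k = f k.+1 *m fr_d G k.
Proof.
have [i|f0 [_ f0E]] := @mx_lift_rows _ _ _ _ (fr_aug G) (fun _ _ => True) (fr_aug F).
  have /(fr_aug_image G)[v vE] : I (fr_aug F i 0).
    apply: (fr_aug_image F _).2; exists (delta_mx 0 i); rewrite -rowE.
    by apply/matrixP => a b; rewrite !ord1 !mxE.
  exists v; split=> //; rewrite vE.
  by apply/matrixP => a b; rewrite !ord1 !mxE.
(* The invariant says that the next square can be filled, so each choice only has to re-establish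
   solvability one level higher. *)
have [||f [fE fP]] := @dependent_choice_fam
  (fun k => 'M[A]_(fr_rk F k, fr_rk G k))
  (fun k f => exists X, X *m fr_d G k = fr_d F k *m f)
  (fun k f g => fr_d F k *m f = g *m fr_d G k) f0.
- by apply: fr_lift0; rewrite -mulmxA f0E fr_d_aug.
- move=> k f [X XE]; exists X; split=> //; apply: fr_lift.
  by rewrite -mulmxA XE mulmxA fr_d_d mul0mx.
by exists f; split; [rewrite fE|move=> k; case: (fP k)].
Qed.

Lemma fr_null_homotopy I (F : free_resolution I)
    (f : forall k, 'M[A]_(fr_rk F k, fr_rk F k)) :
    f 0%N *m fr_aug F = 0 ->
    (forall k, fr_d F k *m f k = f k.+1 *m fr_d F k) ->
  exists h : forall k, 'M[A]_(fr_rk F k, fr_rk F k.+1),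
    f 0%N = h 0%N *m fr_d F 0 /\
    forall k, f k.+1 = h k.+1 *m fr_d F k.+1 + fr_d F k *m h k.
Proof.
move=> f0 fd; have [h0 h0E] := fr_lift0 f0.
(* The invariant makes [f k.+1 - fr_d F k *m h] a cycle, which exactness lifts to the next
   homotopy. *)
have [||h [hE hP]] := @dependent_choice_fam
  (fun k => 'M[A]_(fr_rk F k, fr_rk F k.+1))
  (fun k h => fr_d F k *m (f k - h *m fr_d F k) = 0)
  (fun k h h' => f k.+1 = h' *m fr_d F k.+1 + fr_d F k *m h) h0.
- by rewrite h0E subrr mulmx0.
- move=> k h hd.
  have [|X XE] := @fr_lift _ F _ k (f k.+1 - fr_d F k *m h).
    by rewrite mulmxBl -fd -mulmxA -mulmxBr.
  exists X; split; first by rewrite XE subrK.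
  by rewrite XE opprB addrC subrK mulmxA fr_d_d mul0mx.
by exists h; split; [rewrite hE|move=> k; case: (hP k)].
Qed.

Local Notation red := (map_mx (mcoeff (0%MM : 'X_{1..n}))).

Lemma redM p q r (M : 'M[A]_(p, q)) (N : 'M[A]_(q, r)) :
  red (M *m N) = red M *m red N.
Proof. exact: map_mxM. Qed.

Lemma redD p q (M N : 'M[A]_(p, q)) : red (M + N) = red M + red N.
Proof. exact: map_mxD. Qed.

Lemma redB1 p (M : 'M[A]_p) : red (M - 1%:M) = red M - 1%:M.
Proof. by apply/matrixP => a b; rewrite !mxE mcoeffB mcoeffMn mcoeff1 eqxx. Qed.

(** The composite of comparison maps F -> G -> F is homotopic to the identity. Modulo the variables
    the homotopy moves a cycle only by a boundary, so the reduction of [f] is injective on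
    homology. *)
Lemma tor_dim_le I (F G : free_resolution I) k : (tor_dim F k <= tor_dim G k)%N.
Proof.
have [f [f0 fd]] := fr_chain_map F G; have [g [g0 gd]] := fr_chain_map G F.
pose p k : 'M[A]_(fr_rk F k) := f k *m g k - 1%:M.
have [||h [h0 hd]] := @fr_null_homotopy _ F p.
- by rewrite mulmxBl -mulmxA g0 f0 mul1mx subrr.
- by move=> l; rewrite mulmxBr mulmxBl mulmxA fd -!mulmxA gd mulmx1 mul1mx.
have redp l : red (p l) = red (f l) *m red (g l) - 1%:M.
  by rewrite -redM; exact: redB1.
have ffd l : red (f l.+1) *m fr_dbar G l = fr_dbar F l *m red (f l).
  by rewrite /fr_dbar -[map_mx _ (fr_d G l)]/(red _) -[map_mx _ (fr_d F l)]/(red _)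
     -!redM fd.
have ggd l : red (g l.+1) *m fr_dbar F l = fr_dbar G l *m red (g l).
  by rewrite /fr_dbar -[map_mx _ (fr_d G l)]/(red _) -[map_mx _ (fr_d F l)]/(red _)
     -!redM gd.
have dd I' (H : free_resolution I') l : fr_dbar H l.+1 *m fr_dbar H l = 0.
  rewrite /fr_dbar -[map_mx _ (fr_d H l)]/(red _) -[map_mx _ (fr_d H l.+1)]/(red _).
  by rewrite -redM fr_d_d; apply/matrixP => a b; rewrite !mxE mcoeff0.
case: k => [|k]; rewrite /tor_dim.
  rewrite -{1}(mxrank1 K (fr_rk F 0)) -{1}(mxrank1 K (fr_rk G 0)).
  apply: (rank_homology_le (f := red (f 0%N))); rewrite ?submx1 // => z _ zf.
  have /(congr1 red) := h0; rewrite redp redM => E.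
  have -> : z = z *m red (f 0%N) *m red (g 0%N) -
                z *m red (h 0%N) *m fr_dbar F 0.
    by rewrite -2!mulmxA -E mulmxBr mulmx1 opprB addrC subrK.
  rewrite addmx_sub //; last by rewrite -mulNmx submxMl.
  have /submxP[w ->] := zf.
  by rewrite -mulmxA -ggd mulmxA submxMl.
apply: (rank_homology_le (f := red (f k.+1))).
- by apply/sub_kermxP; rewrite dd.
- by apply/sub_kermxP; rewrite dd.
- by apply/sub_kermxP; rewrite -mulmxA ffd mulmxA mulmx_ker mul0mx.
move=> z /sub_kermxP zd zf.
have /(congr1 red) := hd k; rewrite redp redD !redM => E.
have -> : z = z *m red (f k.+1) *m red (g k.+1) -
              z *m red (h k.+1) *m fr_dbar F k.+1.
  have : z *m (red (f k.+1) *m red (g k.+1) - 1%:M) =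
         z *m red (h k.+1) *m fr_dbar F k.+1.
    by rewrite E mulmxDr !mulmxA zd mul0mx addr0.
  by rewrite mulmxBr mulmx1 mulmxA => <-; rewrite opprB addrC subrK.
rewrite addmx_sub //; last by rewrite -mulNmx submxMl.
have /submxP[w ->] := zf.
by rewrite -mulmxA -ggd mulmxA submxMl.
Qed.

Lemma betti_tor_dim I (F : free_resolution I) k : betti I k = tor_dim F k.
Proof.
rewrite /betti; case: xgetP => [b _ [G ->]|/(_ (tor_dim F k)) []]; last by exists F.
by apply/eqP; rewrite eqn_leq !tor_dim_le.
Qed.

Lemma betti_minimal I (F : free_resolution I) k :
  (forall k, fr_dbar F k = 0) -> betti I k = fr_rk F k.
Proof.
move=> min; rewrite (betti_tor_dim F) /tor_dim min mxrank0 subn0.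
by case: k => // k; rewrite min mxrank_ker mxrank0 subn0.
Qed.

End Comparison.

(** * Homogeneous resolutions and mapping cones *)

Section MappingCone.
Variables (n : nat) (K : fieldType).
Local Notation A := {mpoly K[n]}.
Implicit Types I J : set A.

(* dr and dc are the degrees of the generators indexing rows and columns. *)
Definition hom_mx p q (dr : 'I_p -> nat) (dc : 'I_q -> nat) (M : 'M[A]_(p, q)) :=
  forall i j m, m \in msupp (M i j) -> (mdeg m + dc j = dr i)%N.

Lemma hom_mxM p q r (dp : 'I_p -> nat) (dq : 'I_q -> nat) (dr : 'I_r -> nat)
    (M : 'M[A]_(p, q)) (N : 'M[A]_(q, r)) :
  hom_mx dp dq M -> hom_mx dq dr N -> hom_mx dp dr (M *m N).
Proof.
move=> hM hN i j m; rewrite mxE => /msupp_sum_le /flatten_mapP[s _].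
move=> /msuppM_le /allpairsP[[m1 m2] /= [m1M m2N ->]].
by rewrite mdegD -addnA (hN _ _ _ m2N) (hM _ _ _ m1M).
Qed.

Definition hom_part p q (dr : 'I_p -> nat) (dc : 'I_q -> nat) (M : 'M[A]_(p, q)) :=
  \matrix_(i, j) \sum_(m <- msupp (M i j) | mdeg m + dc j == dr i)
     (M i j)@_m *: 'X_[m].

Lemma mcoeff_hom_part p q (dr : 'I_p -> nat) (dc : 'I_q -> nat) M i j m :
  (@hom_part p q dr dc M i j)@_m =
    if (mdeg m + dc j == dr i)%N then (M i j)@_m else 0.
Proof.
rewrite mxE raddf_sum /=; under eq_bigr do rewrite mcoeffZ mcoeffX.
have [mM|mM] := boolP (m \in msupp (M i j)); last first.
  rewrite (memN_msupp_eq0 mM) if_same big_seq_cond big1 // => m' /andP[m'M _].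
  by case: eqVneq m'M => [->|_ _]; [rewrite (negbTE mM)|rewrite mulr0].
rewrite big_mkcond (bigD1_seq m) ?msupp_uniq //= eqxx mulr1 big1 ?addr0 //.
by move=> m' /negbTE ->; rewrite mulr0 if_same.
Qed.

Lemma hom_partP p q (dr : 'I_p -> nat) (dc : 'I_q -> nat) M :
  hom_mx dr dc (@hom_part p q dr dc M).
Proof.
by move=> i j m; rewrite mcoeff_msupp mcoeff_hom_part; case: ifP => [/eqP //|_]; rewrite eqxx.
Qed.

(** Discarding the terms of [M] of unexpected degree only discards terms of the product of
    unexpected degree, and there are none. Hence every lift through a homogeneous differential can
    be taken homogeneous. *)
Lemma hom_part_mul p q r (dp : 'I_p -> nat) (dq : 'I_q -> nat) (dr : 'I_r -> nat)
    (M : 'M[A]_(p, q)) (N : 'M[A]_(q, r)) :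
    hom_mx dq dr N -> hom_mx dp dr (M *m N) ->
  hom_part dp dq M *m N = M *m N.
Proof.
move=> hN hMN; have hP := hom_mxM (@hom_partP p q dp dq M) hN.
apply/matrixP => i j; apply/mpolyP => m.
have [E|E] := eqVneq (mdeg m + dr j)%N (dp i); last first.
  rewrite !memN_msupp_eq0 //; first by apply: contra E => /hMN ->.
  by apply: contra E => /hP ->.
apply/eqP; rewrite -subr_eq0 -mcoeffB mcoeff_eq0; apply/negP.
have -> : (hom_part dp dq M *m N) i j - (M *m N) i j =
          ((hom_part dp dq M - M) *m N) i j by rewrite mulmxBl !mxE.
rewrite mxE => /msupp_sum_le /flatten_mapP[s _].
move=> /msuppM_le /allpairsP[[m1 m2] /= [m1M m2N mE]].
move: m1M; rewrite mcoeff_msupp [X in X@__]mxE mcoeffD [X in _ + X@__]mxE mcoeffN.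
rewrite mcoeff_hom_part; case: ifP => [_|/eqP m1E _]; first by rewrite subrr eqxx.
case: m1E; rewrite -E mE mdegD -(hN _ _ _ m2N).
by rewrite addnA.
Qed.

(** The number [N] bounds the Castelnuovo-Mumford regularity. The degrees [g] and their bounds are
    carried along because they are what makes the next mapping cone minimal. *)
Definition minimal_resolution I (N : nat) (b : nat -> nat) : Prop :=
  exists (F : free_resolution I) (g : forall k, 'I_(fr_rk F k) -> nat),
    [/\ hom_mx (g 0%N) (fun=> 0%N) (fr_aug F),
        forall k, hom_mx (g k.+1) (g k) (fr_d F k),
        forall k, fr_dbar F k = 0,
        forall k i, (k < g k i <= N + k)%N &
        forall k, fr_rk F k = b k].

Lemma minimal_resolution_betti I N b k :
  minimal_resolution I N b -> betti I k = b k.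
Proof. by case=> F [g [_ _ min _ <-]]; apply: betti_minimal. Qed.

Lemma fr_hom_lift0 I (F : free_resolution I) (g0 : 'I_(fr_rk F 0) -> nat)
    (g1 : 'I_(fr_rk F 1) -> nat) p (dp : 'I_p -> nat) (M : 'M_(p, fr_rk F 0)) :
    hom_mx g1 g0 (fr_d F 0) -> hom_mx dp g0 M -> M *m fr_aug F = 0 ->
  exists2 X, hom_mx dp g1 X & X *m fr_d F 0 = M.
Proof.
move=> hd hM /fr_lift0[X XE]; exists (hom_part dp g1 X); first exact: hom_partP.
by rewrite (@hom_part_mul _ _ _ _ _ g0) ?XE.
Qed.

Lemma fr_hom_lift I (F : free_resolution I) k (g0 : 'I_(fr_rk F k.+1) -> nat)
    (g1 : 'I_(fr_rk F k.+2) -> nat) p (dp : 'I_p -> nat) (M : 'M_(p, fr_rk F k.+1)) :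
    hom_mx g1 g0 (fr_d F k.+1) -> hom_mx dp g0 M -> M *m fr_d F k = 0 ->
  exists2 X, hom_mx dp g1 X & X *m fr_d F k.+1 = M.
Proof.
move=> hd hM /fr_lift[X XE]; exists (hom_part dp g1 X); first exact: hom_partP.
by rewrite (@hom_part_mul _ _ _ _ _ g0) ?XE.
Qed.

Lemma fr_hom_lift_aug I (F : free_resolution I) (g0 : 'I_(fr_rk F 0) -> nat)
    p (dp : 'I_p -> nat) (M : 'M_(p, 1)) :
    hom_mx g0 (fun=> 0%N) (fr_aug F) -> hom_mx dp (fun=> 0%N) M ->
    (forall i, I (M i 0)) ->
  exists2 X, hom_mx dp g0 X & X *m fr_aug F = M.
Proof.
move=> hd hM MI.
have [i|X [_ XE]] := @mx_lift_rows _ _ _ _ (fr_aug F) (fun _ _ => True) M.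
  have /(fr_aug_image F)[v vE] := MI i; exists v; split=> //; rewrite vE.
  by apply/matrixP => a c; rewrite !ord1 !mxE.
exists (hom_part dp g0 X); first exact: hom_partP.
by rewrite (@hom_part_mul _ _ _ _ _ (fun=> 0%N)) ?XE.
Qed.

Section Cone.
Variables (I J I' : set A) (u : 'X_{1..n}).
Hypothesis colonP : forall f, J f <-> I (f * 'X_[u]).
Hypothesis I'P : forall f, I' f <-> exists c, I (f - c * 'X_[u]).
Variables (F : free_resolution I) (G : free_resolution J).
Variable gF : forall k, 'I_(fr_rk F k) -> nat.
Variable gG : forall k, 'I_(fr_rk G k) -> nat.
Arguments gF : clear implicits.
Arguments gG : clear implicits.
Hypothesis homF0 : hom_mx (gF 0) (fun=> 0%N) (fr_aug F).
Hypothesis homF : forall k, hom_mx (gF k.+1) (gF k) (fr_d F k).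
Hypothesis homG0 : hom_mx (gG 0) (fun=> 0%N) (fr_aug G).
Hypothesis homG : forall k, hom_mx (gG k.+1) (gG k) (fr_d G k).
Arguments homF : clear implicits.
Arguments homG : clear implicits.

(* The resolution of A / J obtained by prepending A to G. *)
Definition aug_rk k := if k is k'.+1 then fr_rk G k' else 1%N.
Definition aug_d k : 'M[A]_(aug_rk k.+1, aug_rk k) :=
  match k with 0%N => fr_aug G | k'.+1 => fr_d G k' end.
Definition aug_deg k : 'I_(aug_rk k) -> nat :=
  match k with 0%N => fun=> mdeg u | k'.+1 => fun i => (gG k' i + mdeg u)%N end.

(** Multiplication by [u] maps [J] into [I]. It is lifted to the resolutions by homogeneous
    matrices, the degrees of [G] being shifted by that of [u]. *)
Lemma cone_map : exists alpha : forall k, 'M[A]_(fr_rk G k, fr_rk F k),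
  [/\ alpha 0%N *m fr_aug F = fr_aug G *m ('X_[u])%:M,
      forall k, fr_d G k *m alpha k = alpha k.+1 *m fr_d F k &
      forall k, hom_mx (fun i => gG k i + mdeg u)%N (gF k) (alpha k)].
Proof.
have hGu : hom_mx (fun i => gG 0 i + mdeg u)%N (fun=> 0%N) (fr_aug G *m ('X_[u])%:M).
  move=> i j m; rewrite mul_mx_scalar mxE mulrC (perm_mem (msuppMX _ _)).
  by move=> /mapP[m' /homG0 <- ->]; rewrite mdegD !addn0 addnC.
have [|a0 a0h a0E] := fr_hom_lift_aug homF0 hGu.
  move=> i; rewrite mul_mx_scalar mxE mulrC; apply: (colonP _).1.
  apply: (fr_aug_image G _).2; exists (delta_mx 0 i); rewrite -rowE.
  by apply/matrixP => a c; rewrite !ord1 !mxE.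
have homGu k : hom_mx (fun i => gG k.+1 i + mdeg u)%N
                 (fun i => gG k i + mdeg u)%N (fr_d G k).
  by move=> i j m /homG <-; rewrite addnA.
have [||f [fE fP]] := @dependent_choice_fam
  (fun k => 'M[A]_(fr_rk G k, fr_rk F k))
  (fun k f => hom_mx (fun i => gG k i + mdeg u)%N (gF k) f /\
     exists2 X, hom_mx (fun i => gG k.+1 i + mdeg u)%N (gF k.+1) X &
        X *m fr_d F k = fr_d G k *m f)
  (fun k f g => fr_d G k *m f = g *m fr_d F k) a0.
- split=> //; apply: (fr_hom_lift0 (homF 0)).
    exact: hom_mxM (homGu 0%N) a0h.
  by rewrite -mulmxA a0E mulmxA fr_d_aug mul0mx.
- move=> k f [fh [X Xh XE]]; exists X; split=> //; split=> //.
  apply: (fr_hom_lift (homF k.+1)); first exact: hom_mxM (homGu _) Xh.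
  by rewrite -mulmxA XE mulmxA fr_d_d mul0mx.
exists f; rewrite fE; split=> // k; first by have [_ ->] := fP k.
by have [[]] := fP k.
Qed.

Section WithMap.
Variable alpha : forall k, 'M[A]_(fr_rk G k, fr_rk F k).
Arguments alpha : clear implicits.
Hypothesis alpha0 : alpha 0%N *m fr_aug F = fr_aug G *m ('X_[u])%:M.
Hypothesis alphad : forall k, fr_d G k *m alpha k = alpha k.+1 *m fr_d F k.
Hypothesis alphah : forall k, hom_mx (fun i => gG k i + mdeg u)%N (gF k) (alpha k).

Definition cone_rk k := (fr_rk F k + aug_rk k)%N.
Definition cone_d k : 'M[A]_(cone_rk k.+1, cone_rk k) :=
  block_mx (fr_d F k) 0 (alpha k) (- aug_d k).
Definition cone_aug : 'cV[A]_(cone_rk 0) :=  col_mx (fr_aug F) ('X_[u])%:M.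

Lemma cone_dE k (x : 'rV_(fr_rk F k.+1)) (y : 'rV_(aug_rk k.+1)) :
  row_mx x y *m cone_d k =
    row_mx (x *m fr_d F k + y *m alpha k) (- (y *m aug_d k)).
Proof. by rewrite mul_row_block mulmx0 add0r mulmxN. Qed.

Lemma cone_aug_image f : I' f <-> exists v : 'rV_(cone_rk 0), v *m cone_aug = f%:M.
Proof.
rewrite I'P; split=> [[c /(fr_aug_image F)[v vE]]|[v]].
  exists (row_mx v c%:M : 'rV_(_ + 1)); rewrite mul_row_col vE mul_scalar_mx.
  by rewrite scale_scalar_mx -raddfD /= subrK.
rewrite -[v]hsubmxK mul_row_col => E.
exists ((rsubmx v : 'rV_1) 0 0); apply: (fr_aug_image F _).2.
exists (lsubmx v); rewrite raddfB /= -E.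
rewrite -[X in _ = _ + _ *m X - _]/('X_[u])%:M [X in _ = _ + X *m _ - _]mx11_scalar.
by rewrite mul_scalar_mx scale_scalar_mx addrK.
Qed.

Lemma cone_exact0 (v : 'rV_(cone_rk 0)) : v *m cone_aug = 0 <-> exists w, v = w *m cone_d 0.
Proof.
split=> [|[w ->]].
  rewrite -[v]hsubmxK; move: (lsubmx v) (rsubmx v) => x y.
  rewrite mul_row_col => E.
  (* The relation puts [y] times the monomial [u] into [I], hence [y] into the colon ideal [J];
     correcting [x] by the image of the lift then makes it a syzygy of [F]. *)
  have [z zE] : exists z, z *m fr_aug G = y.
    rewrite [y]mx11_scalar; apply/(fr_aug_image G _).1/(colonP _).2.
    apply: (fr_aug_image F _).2; exists (- x).
    rewrite mulNmx; apply/eqP; rewrite eq_sym -addr_eq0 addrC -E; apply/eqP.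
    by congr (_ + _); rewrite [y in RHS]mx11_scalar mul_scalar_mx scale_scalar_mx.
  have [|w wE] := fr_lift0 (F := F) (M := x + z *m alpha 0%N).
    by rewrite mulmxDl -mulmxA alpha0 mulmxA zE.
  exists (row_mx w (- z) : 'rV_(_ + aug_rk 1)).
  rewrite cone_dE wE !mulNmx opprK.
  by rewrite addrK -[z *m aug_d 0]/(z *m fr_aug G) zE.
rewrite -[w]hsubmxK cone_dE mul_row_col.
rewrite mulmxDl -!mulmxA fr_d_aug mulmx0 add0r alpha0 mulNmx -mulmxA.
by apply/eqP; rewrite subr_eq0.
Qed.

Lemma cone_exact k (v : 'rV_(cone_rk k.+1)) :
  v *m cone_d k = 0 <-> exists w, v = w *m cone_d k.+1.
Proof.
have augdd l : aug_d l.+1 *m aug_d l = 0.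
  by case: l => [|l]; [apply: fr_d_aug|apply: fr_d_d].
split=> [|[w ->]]; last first.
  rewrite -[w]hsubmxK; move: (lsubmx w) (rsubmx w) => x y.
  rewrite !cone_dE mulmxDl -!mulmxA fr_d_d mulmx0 add0r -alphad.
  rewrite !mulNmx -!mulmxA augdd mulmx0 !oppr0.
  by rewrite -[aug_d k.+1]/(fr_d G k) subrr row_mx0.
rewrite -[v]hsubmxK; move: (lsubmx v) (rsubmx v) => x y.
rewrite cone_dE -row_mx0 => /eq_row_mx[E1 /eqP]; rewrite oppr_eq0 => /eqP E2.
have [z zE] : exists z, y = z *m aug_d k.+1.
  case: k x y E1 E2 {v} => [|k] x y E1 E2; first exact/fr_exact0.
  exact/fr_exact.
have [|w wE] := fr_lift (F := F) (M := x + z *m alpha k.+1).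
  rewrite mulmxDl -mulmxA -alphad mulmxA.
  by rewrite -[z *m fr_d G k]/(z *m aug_d k.+1) -zE.
exists (row_mx w (- z) : 'rV_(_ + aug_rk k.+2)).
by rewrite cone_dE wE !mulNmx opprK addrK zE.
Qed.

Definition cone : free_resolution I' :=
  FreeResolution cone_aug_image cone_exact0 cone_exact.

Definition cone_deg k (i : 'I_(cone_rk k)) : nat :=
  match split i with inl a => gF k a | inr b => aug_deg b end.
Arguments cone_deg : clear implicits.

Lemma cone_hom0 : hom_mx (cone_deg 0) (fun=> 0%N) cone_aug.
Proof.
move=> i j m; rewrite /cone_aug /cone_deg mxE; case: (split i) => a; first exact: homF0.
rewrite !ord1 mxE eqxx mulr1n => /mem_msuppXP <- /=.
by rewrite addn0.
Qed.

Lemma cone_hom k : hom_mx (cone_deg k.+1) (cone_deg k) (cone_d k).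
Proof.
move=> i j m; rewrite /cone_d /cone_deg mxE; case: (split i) => a; rewrite mxE;
  case: (split j) => b.
- exact: homF.
- by rewrite mxE msupp0.
- exact: alphah.
rewrite mxE (perm_mem (msuppN _)); case: k a b {i j} => [|k] a b /=.
  by move=> /homG0 <-; rewrite addn0.
by move=> /homG <-; rewrite addnA.
Qed.

Variables (N M : nat).
Hypothesis boundF : forall k i, (k < gF k i <= N + k)%N.
Hypothesis boundG : forall k i, (k < gG k i <= M + k)%N.
Hypothesis u_gt0 : (0 < mdeg u)%N.
Hypothesis leNu : (N <= mdeg u)%N.

Lemma cone_bound k i : (k < cone_deg k i <= maxn N (mdeg u + M.-1) + k)%N.
Proof.
rewrite /cone_deg; case: (split i) => a; first by have := boundF a; lia.
by case: k a {i} => [|k] a /=; [lia | have := boundG a; lia].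
Qed.

Lemma cone_min k :
  fr_dbar F k = 0 -> (forall k', fr_dbar G k' = 0) -> fr_dbar cone k = 0.
Proof.
move=> minF minG; apply/matrixP => i j; rewrite !mxE.
have min00 p q (D : 'M[A]_(p, q)) a b :
    map_mx (mcoeff (0%MM : 'X_{1..n})) D = 0 -> (D a b)@_0%MM = 0.
  by move=> /matrixP/(_ a b); rewrite !mxE.
case: (split i) => a; rewrite mxE; case: (split j) => b.
- exact: min00.
- by rewrite mxE mcoeff0.
(* A constant term of [alpha] would force [gG k a + mdeg u = gF k b], but the left side is at least
   [k + 1 + N] and the right side at most [N + k]. *)
- apply/eqP; rewrite mcoeff_eq0; apply/negP => /alphah; rewrite mdeg0.
  by have := boundF b; have := boundG a; lia.
rewrite mxE mcoeffN; apply/eqP; rewrite oppr_eq0; apply/eqP.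
case: k a b {i j minF} => [|k] a b /=; last exact/min00/minG.
apply/eqP; rewrite mcoeff_eq0; apply/negP => /homG0; rewrite mdeg0.
by have := boundG a; lia.
Qed.

End WithMap.
End Cone.

(** Here J = I : u and I' = I + (u), so the cone comes from 0 -> A/J -> A/I -> A/I' -> 0, the first
    map being multiplication by [u]. The resolution of A/J starts with A itself, which explains the
    1 and the index shift in [c]. *)
Lemma minimal_resolution_cone I J I' (u : 'X_{1..n}) N M b c :
    (forall f, J f <-> I (f * 'X_[u])) ->
    (forall f, I' f <-> exists c, I (f - c * 'X_[u])) ->
    minimal_resolution I N b -> minimal_resolution J M c ->
    (0 < mdeg u)%N -> (N <= mdeg u)%N ->
  minimal_resolution I' (maxn N (mdeg u + M.-1))
    (fun k => b k + (if k is k'.+1 then c k' else 1))%N.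
Proof.
move=> JP I'P [F [gF [homF0 homF minF bF rF]]] [G [gG [homG0 homG minG bG rG]]] u0 Nu.
have [al [al0 ald alh]] := cone_map JP homF0 homF homG0 homG.
exists (cone JP I'P al0 ald), (@cone_deg I J u F G gF gG); split.
- exact: cone_hom0.
- by move=> k; apply: cone_hom.
- by move=> k; apply: (cone_min JP I'P homG0 al0 ald alh bF bG).
- by move=> k i; apply: cone_bound.
by case=> [|k]; rewrite /= /cone_rk /= ?rF ?rG.
Qed.

Lemma minimal_resolution0 I : (forall f, I f <-> f = 0) ->
  minimal_resolution I 0 (fun=> 0%N).
Proof.
move=> I0.
have P1 f : I f <-> exists v : 'rV[A]_0, v *m (0 : 'cV_0) = f%:M.
  rewrite I0; split=> [->|[v]]; first by exists 0; rewrite mulmx0 raddf0.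
  by rewrite mulmx0 => /matrixP/(_ 0 0); rewrite !mxE eqxx mulr1n.
have P2 (v : 'rV[A]_0) : v *m (0 : 'cV_0) = 0 <->
    exists w, v = w *m (0 : 'M_(0, 0)).
  by rewrite mulmx0; split=> // _; exists 0; rewrite [v]thinmx0 [RHS]thinmx0.
have P3 (k : nat) (v : 'rV[A]_0) : v *m (0 : 'M_(0, 0)) = 0 <->
    exists w, v = w *m (0 : 'M_(0, 0)).
  by rewrite mulmx0; split=> // _; exists 0; rewrite [v]thinmx0 [RHS]thinmx0.
exists (@FreeResolution n K I (fun=> 0%N) (fun=> 0) 0 P1 P2 P3), (fun _ _ => 0%N).
by split=> //= [[]|k []|k|k []] //; apply/matrixP => -[].
Qed.

End MappingCone.

(** * Partial sums of exponents and the dominance order *)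

Section PartialSums.
Variable n : nat.
Implicit Types (m u v w : 'X_{1..n}) (t D : nat).

(** The exponent of x_1, ..., x_t together. Dominance, the reverse lexicographic order and
    membership in the ideals below all become linear conditions on these numbers, within reach of
    [lia]. *)
Definition psum t m : nat := (\sum_(l < n | l < t) m l)%N.

Lemma psum0 m : psum 0 m = 0%N.
Proof. by rewrite /psum big_pred0. Qed.

Lemma psumS (l : 'I_n) m : psum l.+1 m = (psum l m + m l)%N.
Proof.
rewrite /psum (bigD1 l) //= addnC; congr (_ + _)%N.
by apply: eq_bigl => k; rewrite ltnS ltn_neqAle andbC.
Qed.

Lemma psum_mdeg t m : (n <= t)%N -> psum t m = mdeg m.
Proof.
move=> nt; rewrite mdegE; apply: eq_bigl => l.
by rewrite (leq_trans (ltn_ord l)).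
Qed.

Lemma psumD t m m' : psum t (m + m')%MM = (psum t m + psum t m')%N.
Proof. by rewrite /psum -big_split /=; apply: eq_bigr => l _; rewrite mnmDE. Qed.

Lemma psumU t (l : 'I_n) : psum t U_(l)%MM = (l < t)%N.
Proof.
rewrite /psum; have [lt|lt] := boolP (l < t)%N.
  rewrite (bigD1 l) //= mnm1E eqxx big1 // => k /andP[_ /negbTE kl].
  by rewrite mnm1E eq_sym kl.
rewrite big1 // => k kt; rewrite mnm1E; case: eqP => // lk.
by rewrite lk kt in lt.
Qed.

Lemma psumMn t m k : psum t (m *+ k)%MM = (psum t m * k)%N.
Proof. by rewrite /psum big_distrl; apply: eq_bigr => l _; rewrite mulmnE. Qed.

Lemma leq_psum t t' m : (t <= t')%N -> (psum t m <= psum t' m)%N.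
Proof.
move=> tt'; rewrite /psum big_mkcond [leqRHS]big_mkcond /=; apply: leq_sum => l _.
by case: (ltnP l t) => // lt; rewrite (leq_trans lt tt').
Qed.

Lemma psum_le_mdeg t m : (psum t m <= mdeg m)%N.
Proof.
by rewrite -(psum_mdeg m (leq_maxl n t)) leq_psum // leq_maxr.
Qed.

Lemma lem_psum t m m' : (m <= m')%MM -> (psum t m <= psum t m')%N.
Proof. by move=> /mnm_lepP mm'; apply: leq_sum => l _. Qed.

Lemma lem_mdeg m m' : (m <= m')%MM -> (mdeg m <= mdeg m')%N.
Proof. by move=> /(lem_psum n); rewrite !psum_mdeg. Qed.

Lemma psum_inj m m' : (forall t, psum t m = psum t m') -> m = m'.
Proof.
move=> E; apply/mnmP => l; have := E l.+1.
by rewrite !psumS E => /addnI.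
Qed.

Lemma lem_mdeg_eq m m' : (m <= m')%MM -> mdeg m = mdeg m' -> m = m'.
Proof.
move=> mm' E; rewrite -(submK mm').
suff -> : (m' - m)%MM = 0%MM by rewrite add0m.
apply/eqP; rewrite -mdeg_eq0.
by have := congr1 (@mdeg n) (submK mm'); rewrite mdegD E; lia.
Qed.

(** The first [D] factors of [m], its variables being listed by increasing index. Among the divisors
    of degree [D] it has the largest partial sums, so conditions with thresholds at most [D] pass
    from [m] to it. *)
Definition trunc D m : 'X_{1..n} := [multinom minn (m l) (D - psum l m) | l < n].

Lemma psum_trunc t D m : psum t (trunc D m) = minn D (psum t m).
Proof.
have H r : (r <= n)%N -> psum r (trunc D m) = minn D (psum r m).
  elim: r => [|r IH] rn; first by rewrite !psum0 minn0.
  rewrite -[r]/(nat_of_ord (Ordinal rn)) !psumS /= IH ?(ltnW rn) // mnmE /=.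
  by lia.
have [tn|/ltnW nt] := leqP t n; first exact: H.
by rewrite !(psum_mdeg _ nt) -!(psum_mdeg _ (leqnn n)) H.
Qed.

Lemma mdeg_trunc D m : mdeg (trunc D m) = minn D (mdeg m).
Proof. by rewrite -!(psum_mdeg _ (leqnn n)) psum_trunc. Qed.

Lemma trunc_lem D m : (trunc D m <= m)%MM.
Proof. by apply/mnm_lepP => l; rewrite mnmE geq_minl. Qed.

(** Dominance with [u] the larger element: moving weight to earlier variables goes up. *)
Definition dom v u := mdeg v = mdeg u /\ forall t, (psum t v <= psum t u)%N.

Lemma dom_refl u : dom u u. Proof. by split. Qed.

Lemma domD u v u' v' : dom u v -> dom u' v' -> dom (u + u')%MM (v + v')%MM.
Proof.
move=> [e h] [e' h']; split; first by rewrite !mdegD e e'.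
by move=> t; rewrite !psumD leq_add.
Qed.

Lemma dom_U (k l : 'I_n) : (l <= k)%N -> dom U_(k)%MM U_(l)%MM.
Proof. by move=> lk; split=> [|t]; rewrite ?mdeg1 // !psumU; lia. Qed.

Definition psum_total m : nat := (\sum_(t < n) psum t m)%N.

Lemma dom_psum_total u v : dom u v -> u != v -> (psum_total u < psum_total v)%N.
Proof.
move=> [e h] ne; rewrite ltn_neqAle leq_sum ?andbT //; apply: contra ne => /eqP E.
apply/eqP/psum_inj => t.
have [tn|nt] := ltnP t n; last by rewrite !psum_mdeg.
have /eqP := E; rewrite /psum_total eqn_leq => /andP[_].
rewrite (bigD1 (Ordinal tn)) //= [leqRHS](bigD1 (Ordinal tn)) //= => le.
apply/eqP; rewrite eqn_leq h /=.
move: le; apply: contraTT; rewrite -!ltnNge => lt.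
by rewrite -addSn leq_add // leq_sum.
Qed.

(** Indices start at 0, so this is also the number of variables preceding the last one of [u], as in
    the Eliahou-Kervaire formula. It is 0 for [u = 0]. *)
Definition max_index u : nat := (\max_(l < n | (0 < u l)%N) l)%N.

Lemma max_index_leq u (l : 'I_n) : (0 < u l)%N -> (l <= max_index u)%N.
Proof. by move=> ul; apply: (@leq_bigmax_cond _ (fun l => 0 < u l)%N (fun l => nat_of_ord l)). Qed.

Lemma max_index_ord u : (0 < mdeg u)%N -> exists2 l : 'I_n, (0 < u l)%N & max_index u = l.
Proof.
rewrite mdegE lt0n sum_nat_eq0 negb_forall => /existsP[l ul].
have [|k uk kE] := @eq_bigmax_cond _ (fun l : 'I_n => 0 < u l)%N (fun l => nat_of_ord l).
  by apply/card_gt0P; exists l; rewrite unfold_in /= lt0n; move: ul.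
by exists k.
Qed.

Lemma max_index_psum u t : (max_index u < t)%N -> psum t u = mdeg u.
Proof.
move=> ut; rewrite mdegE /psum [LHS]big_mkcond; apply: eq_bigr => l _ /=.
case: (ltnP l t) => // tl; case: (posnP (u l)) => // /max_index_leq; lia.
Qed.

Definition upclosed (P : pred 'X_{1..n}) := forall m m', (m <= m')%MM -> P m -> P m'.

(** Strong stability, required in the single degree [D]. *)
Definition domclosed D (P : pred 'X_{1..n}) :=
  forall v u, mdeg v = D -> dom v u -> P v -> P u.

Definition vars q (w : 'X_{1..n}) : bool := [exists l : 'I_n, (l < q)%N && (0 < w l)%N].

Lemma varsE q w : vars q w = (0 < psum q w)%N.
Proof.
rewrite /vars lt0n /psum sum_nat_eq0 negb_forall; apply: eq_existsb => l.
by rewrite negb_imply lt0n.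
Qed.

End PartialSums.

(** * Monomial ideals built by adding one generator at a time *)

Section MonomialResolutions.
Variables (n : nat) (K : fieldType).
Local Notation A := {mpoly K[n]}.
Implicit Types (P Q : pred 'X_{1..n}) (u v w m : 'X_{1..n}).

(** For [upclosed P] this is the monomial ideal with monomials [P]; working with boolean predicates
    reduces colons and sums of ideals to computations with exponents. *)
Definition mspan P : set A := [set f | forall m, m \in msupp f -> P m].

Definition mres P N b := minimal_resolution (mspan P) N b.

Lemma eq_mres P Q N b c : P =1 Q -> b =1 c -> mres P N b -> mres Q N c.
Proof. by move=> /funext -> /funext ->. Qed.

Lemma mres_leq P N N' b : (N <= N')%N -> mres P N b -> mres P N' b.
Proof.
move=> NN' [F [g [g1 g2 g3 g4 g5]]]; exists F, g; split=> // k i.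
by have := g4 k i; lia.
Qed.

Lemma mspan_colon P u (f : A) :
  mspan (fun w => P (u + w)%MM) f <-> mspan P (f * 'X_[u]).
Proof.
split=> H m.
  by rewrite (perm_mem (msuppMX _ _)) => /mapP[m' /H m'P ->].
by move=> mf; apply: H; rewrite (perm_mem (msuppMX _ _)); apply/mapP; exists m.
Qed.

Lemma mspan_add P u (f : A) :
  mspan (fun m => P m || (u <= m)%MM) f <-> exists c, mspan P (f - c * 'X_[u]).
Proof.
split=> [H|[c H] m].
  (* The multiplier collects the terms of [f] outside [P], each divided by [u]. *)
  exists (\sum_(m <- msupp f | ~~ P m) f@_m *: 'X_[m - u]).
  rewrite mulr_suml big_seq_cond.
  under eq_bigr => m /andP[/H /orP[->//|um] _] do rewrite -scalerAl -mpolyXD submK //.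
  rewrite -big_seq_cond.
  rewrite {1}[f]mpolyE (bigID P) /= addrK => m.
  move=> /msupp_sum_le /flatten_mapP[m']; rewrite mem_filter => /andP[Pm' _].
  by move=> /msuppZ_le; rewrite msuppX inE => /eqP ->.
move=> mf; have : m \in msupp ((f - c * 'X_[u]) + c * 'X_[u]) by rewrite subrK.
move=> /msuppD_le; rewrite mem_cat => /orP[/H ->//|].
rewrite (perm_mem (msuppMX _ _)) => /mapP[m' _ ->].
by rewrite lem_addr orbT.
Qed.

Lemma mres_add P u N M b c :
    mres P N b -> mres (fun w => P (u + w)%MM) M c ->
    (0 < mdeg u)%N -> (N <= mdeg u)%N ->
  mres (fun m => P m || (u <= m)%MM) (maxn N (mdeg u + M.-1))
    (fun k => b k + (if k is k'.+1 then c k' else 1))%N.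
Proof.
by move=> rP rQ; apply: minimal_resolution_cone rP rQ;
  [apply: mspan_colon | apply: mspan_add].
Qed.

Lemma mres0 : mres pred0 0 (fun=> 0%N).
Proof.
apply: minimal_resolution0 => f; split=> [H|->]; last by move=> m; rewrite msupp0.
by apply: msuppnil0; case E: (msupp f) => [//|m s]; have := H m; rewrite E mem_head => /(_ isT).
Qed.

(** This is the Koszul complex: a new variable is a nonzerodivisor modulo the earlier ones, so the
    colon ideal is unchanged and Pascal's rule gives the ranks. *)
Lemma mres_vars q : (q <= n)%N -> mres (vars q) 1 (fun k => 'C(q, k.+1)).
Proof.
elim: q => [|q IH] qn.
  apply: (mres_leq (leq0n 1)); apply: eq_mres mres0 => [w|k]; last by rewrite bin0n.
  by rewrite varsE psum0.
have IHq := IH (ltnW qn); pose l := Ordinal qn.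
have := @mres_add _ U_(l)%MM 1 1 _ (fun k => 'C(q, k.+1)) IHq.
rewrite mdeg1 => /(_ _ isT isT) H.
apply: eq_mres (H _) => [w|k|].
- rewrite !varsE lep1mP -[q.+1]/(l.+1) psumS /=; lia.
- by rewrite binS; case: k => [|k]; rewrite ?bin0 // binS.
by apply: eq_mres IHq => // w; rewrite !varsE psumD psumU ltnn.
Qed.

Lemma mres_linear P u q N b :
    mres P N b -> (q <= n)%N -> (forall w, P (u + w)%MM = vars q w) ->
    (0 < mdeg u)%N -> (N <= mdeg u)%N ->
  mres (fun m => P m || (u <= m)%MM) (mdeg u) (fun k => b k + 'C(q, k))%N.
Proof.
move=> rP qn uP u0 Nu.
have : mres (fun w => P (u + w)%MM) 1 (fun k => 'C(q, k.+1)).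
  by apply: eq_mres (mres_vars qn) => // w; rewrite uP.
move=> /(mres_add rP) /(_ u0 Nu); rewrite addn0 (maxn_idPr Nu).
by apply: eq_mres => // -[|k]; rewrite ?bin0.
Qed.

Lemma mres_square P u (q : 'I_n) N b :
    mres P N b -> (forall w, P (u + w)%MM = vars q w || (1 < w q)%N) ->
    (0 < mdeg u)%N -> (N <= mdeg u)%N ->
  mres (fun m => P m || (u <= m)%MM) (mdeg u).+1 (fun k => b k + 'C(q.+1, k))%N.
Proof.
move=> rP uP u0 Nu; have rq := mres_vars (ltnW (ltn_ord q)).
have := @mres_add _ (U_(q) *+ 2)%MM 1 1 _ (fun k => 'C(q, k.+1)) rq.
rewrite mdegMn mdeg1 => H; have {}H := H _ isT isT.
have /H {}H : mres (fun w => vars q (U_(q) *+ 2 + w)%MM) 1 (fun k => 'C(q, k.+1)).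
  by apply: eq_mres rq => // w; rewrite !varsE psumD psumMn psumU ltnn.
have : mres (fun w => P (u + w)%MM) 2 (fun k => 'C(q.+1, k.+1)).
  apply: eq_mres H => [w|k]; last by rewrite binS; case: k => [|k]; rewrite ?bin0.
  rewrite uP; congr (_ || _); apply/mnm_lepP/idP => [/(_ q)|wq l].
    by rewrite mulmnE mnm1E eqxx.
  by rewrite mulmnE mnm1E; case: eqP => [<-|].
move=> /(mres_add rP) /(_ u0 Nu); rewrite addn1 (maxn_idPr _) 1?leqW //.
by apply: eq_mres => // -[|k]; rewrite ?bin0.
Qed.

(** Adds u times the maximal ideal, one multiple u x_q at a time. The multiples by the first [q0]
    variables are already in [P], and the colon ideal of u x_q is generated by all variables of
    smaller index. *)
Lemma mres_chain P u q0 N b :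
    mres P N b -> upclosed P -> (q0 <= n)%N ->
    (forall w, P (u + w)%MM = vars q0 w) -> (N <= (mdeg u).+1)%N ->
  mres (fun m => P m || [exists q : 'I_n, (q0 <= q)%N && (u + U_(q) <= m)%MM])
    (mdeg u).+1 (fun k => b k + \sum_(q0 <= q < n) 'C(q, k))%N.
Proof.
move=> rP upP q0n uP Nu.
pose Pr r m := P m || [exists q : 'I_n, [&& q0 <= q, q < r & (u + U_(q) <= m)%MM]]%N.
suff H r : (q0 <= r <= n)%N ->
    mres (Pr r) (mdeg u).+1 (fun k => b k + \sum_(q0 <= q < r) 'C(q, k))%N.
  apply: eq_mres (H n _) => [m||] //; last by rewrite q0n leqnn.
  by rewrite /Pr; congr (_ || _); apply: eq_existsb => q; rewrite ltn_ord.
elim: r => [|r IH] /andP[q0r rn].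
  move: q0r; rewrite leqn0 => /eqP q00; apply: (mres_leq Nu).
  apply: eq_mres rP => [m|k]; last by rewrite q00 big_geq // addn0.
  rewrite /Pr; case: existsP => [[q]|_]; last by rewrite orbF.
  by rewrite ltn0 andbF.
move: q0r; rewrite leq_eqVlt => /orP[/eqP q0r|q0r].
  apply: (mres_leq Nu).
  apply: eq_mres rP => [m|k]; last by rewrite q0r big_geq // addn0.
  rewrite /Pr; case: existsP => [[q /and3P[]]|_]; last by rewrite orbF.
  by rewrite q0r; lia.
have {}IH := IH _; rewrite -ltnS q0r (ltnW rn) in IH; have {}IH := IH isT.
pose q := Ordinal rn.
have := @mres_linear (Pr r) (u + U_(q))%MM r _ _ IH (ltnW rn).
rewrite mdegD mdeg1 addn1 => H; apply: eq_mres (H _ isT (leqnn _)) => [m|k|w].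
- rewrite /Pr -orbA; congr (_ || _); apply/orP/existsP.
    case=> [/existsP[q' /and3P[h1 h2 h3]]|h].
      by exists q'; rewrite h1 h3 ltnW.
    by exists q; apply/and3P; split=> //=; rewrite -ltnS.
  case=> q' /and3P[h1 h2 h3]; move: h2; rewrite ltnS leq_eqVlt => /orP[/eqP h2|h2].
    by right; rewrite (_ : q = q') //; apply: val_inj.
  by left; apply/existsP; exists q'; rewrite h1 h2 h3.
- by rewrite big_nat_recr //= addnA.
rewrite /Pr -addmA uP !varsE psumD psumU.
have -> : (r < q0)%N = false by lia.
rewrite add0n; apply/orP/idP => [[w0|/existsP[q' /and3P[h1 h2]]]|].
- by apply: leq_trans w0 _; apply: leq_psum; lia.
- move=> /mnm_lepP /(_ q'); rewrite !mnmDE leq_add2l !mnm1E eqxx.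
  have -> : (q == q') = false by rewrite -val_eqE /=; lia.
  rewrite add0n => wq'; rewrite -varsE; apply/existsP; exists q'.
  by rewrite h2.
rewrite -varsE => /existsP[l /andP[lr wl]].
have [lq|ql] := ltnP l q0.
  by left; rewrite -varsE; apply/existsP; exists l; rewrite lq.
right; apply/existsP; exists l; rewrite ql lr /=.
apply/mnm_lepP => k; rewrite !mnmDE leq_add2l; apply: leq_trans (leq_addl _ _).
by rewrite mnm1E; case: eqP => [<-|].
Qed.

(* The missing elements u of degree D are added by decreasing psum_total, which
   makes P : u generated by the variables preceding the last one of u. *)
Lemma mres_fill P P' D N b :
    mres P N b -> upclosed P -> upclosed P' -> (forall m, P m -> P' m) ->
    (forall m, P m -> (D <= mdeg m)%N -> exists v, [/\ (v <= m)%MM, mdeg v = D & P v]) ->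
    (forall m, P' m -> ~~ P m -> exists v, [/\ (v <= m)%MM, mdeg v = D & P' v]) ->
    domclosed D P -> domclosed D P' -> (N <= D)%N -> (0 < D)%N ->
  mres P' D (fun k => b k +
    \sum_(u : 'X_{1..n < D.+1} | [&& mdeg u == D, P' u & ~~ P u]) 'C(max_index u, k))%N.
Proof.
pose miss Q := [pred u : 'X_{1..n < D.+1} | [&& mdeg u == D, P' u & ~~ Q u]].
move: {2}(#|miss P|) (leqnn #|miss P|) => s.
elim: s P N b => [|s IH] P N b.
  rewrite leqn0 => /eqP /card0_eq E rP upP upP' PP' genP genP' _ _ ND _.
  apply: (mres_leq ND); apply: eq_mres rP => [m|k]; last first.
    by rewrite big_pred0 ?addn0.
  apply/idP/idP => [/PP'//|P'm]; apply: contraT => nPm.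
  have [v [vm vD P'v]] := genP' m P'm nPm.
  have vb : (mdeg v < D.+1)%N by rewrite vD.
  have := E (BMultinom vb); rewrite !inE /= vD eqxx P'v /= => /negbFE Pv.
  by case/negP: nPm; apply: upP vm Pv.
move=> cs rP upP upP' PP' genP genP' domP domP' ND D0.
have [/eqP c0|] := posnP #|miss P|.
  by apply: (IH P N b) => //; rewrite (eqP c0).
move=> /card_gt0P[u0 u0miss].
have [u umiss umax] := @arg_maxnP _ u0 (miss P) (fun x => psum_total (bmnm x)) u0miss.
have /and3P[/eqP uD P'u nPu] := umiss.
(* As [psum_total] strictly increases along dominance, maximality of [u] puts every strictly larger
   monomial of [P'] into [P]. *)
have domu (u' : 'X_{1..n}) : dom (bmnm u) u' -> u' <> bmnm u -> P u'.
  move=> uu' ne; apply: contraT => nPu'.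
  have u'D : mdeg u' = D by case: uu' => <-.
  have vb : (mdeg u' < D.+1)%N by rewrite u'D.
  have : miss P (BMultinom vb).
    by rewrite inE /= u'D eqxx nPu' andbT /=; apply: (domP' (bmnm u)).
  move=> /umax /=; rewrite leqNgt dom_psum_total //.
  by apply/eqP => E; apply: ne.
have u_gt0 : (0 < mdeg u)%N by rewrite uD.
have [lu ulu luE] := max_index_ord u_gt0.
have colon w : P (u + w)%MM = vars (max_index u) w.
  apply/idP/existsP => [Puw|[l /andP[lmx wl]]].
    apply/existsP; apply: contraT => /existsPn nw.
    have [|v [vuw vD Pv]] := genP _ Puw; first by rewrite mdegD uD leq_addr.
    (* If [w] avoids the variables before the last one of [u], then every degree [D] divisor [v] of
       the product is dominated by [u], and closure would put [u] into [P]. *)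
    suff /domP : dom v (bmnm u) by move=> /(_ vD Pv); rewrite (negbTE nPu).
    split; first by rewrite vD uD.
    move=> t; have [tmx|mxt] := leqP t (max_index u); last first.
      by rewrite (max_index_psum mxt) uD -vD psum_le_mdeg.
    apply: leq_trans (lem_psum t vuw) _; rewrite psumD.
    suff -> : psum t w = 0%N by rewrite addn0.
    rewrite /psum big1 // => l lt; have := nw l.
    by rewrite (leq_trans lt tmx) /= -leqNgt leqn0 => /eqP.
  have le1 : (U_(lu) <= u)%MM by rewrite lep1mP -lt0n.
  have Eu : (u - U_(lu) + U_(lu))%MM = u by apply: submK.
  (* Exchanging the last variable of [u] for an earlier one dividing [w] moves strictly up in
     dominance and yields a divisor of [u + w]. *)
  have Pu' : P (u - U_(lu) + U_(l))%MM.
    apply: domu.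
      rewrite -{1}Eu; apply: domD; [exact: dom_refl|apply: dom_U; lia].
    rewrite -{2}Eu => /addmI /eqP; rewrite eq_mnm1 => /eqP E.
    by rewrite luE E ltnn in lmx.
  apply: upP Pu'; apply/mnm_lepP => k; rewrite !mnmDE mnmBE !mnm1E.
  by case: (eqVneq l k) => [<-|_]; case: (lu == _); lia.
have mxn : (max_index u <= n)%N by rewrite luE ltnW.
have := mres_linear rP mxn colon u_gt0; rewrite uD => /(_ ND).
set P'' := (fun m => _) => rP''.
have missE (v : 'X_{1..n < D.+1}) : miss P'' v = miss P v && (v != u).
  rewrite !inE /P'' /=; case: (boolP (mdeg v == D)) => //= /eqP vD.
  case: (P' v) => //=; rewrite negb_or; congr (_ && ~~ _).
  apply/idP/eqP => [uv|->]; last exact: lepm_refl.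
  by apply/val_inj/esym/lem_mdeg_eq => //; rewrite uD vD.
have cE : (#|miss P''| < #|miss P|)%N.
  apply: proper_card; apply/properP; split.
    by apply/fintype.subsetP => v vm; have : miss P'' v := vm; rewrite missE => /andP[].
  exists u => //; apply/negP => um; have : miss P'' u := um.
  by rewrite missE eqxx andbF.
have := IH P'' D _ _ rP'' _ upP' _ _ _ _ domP' (leqnn _) D0.
rewrite -ltnS => H; apply: eq_mres (H _ _ _ _ _ _) => [//|k||||||].
- rewrite -addnA [in RHS](bigD1 u) //=; congr (_ + (_ + _))%N.
  by apply: eq_bigl => v; have := missE v; rewrite !inE => ->.
- exact: leq_trans cE cs.
- move=> m m' mm' /orP[/(upP _ _ mm') Pm'|um]; first by rewrite /P'' Pm'.
  by rewrite /P'' (lepm_trans um mm') orbT.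
- move=> m /orP[/PP'//|um]; exact: upP' um P'u.
- move=> m /orP[Pm Dm|um _].
    have [v [vm vD Pv]] := genP m Pm Dm; exists v; split=> //.
    by rewrite /P'' Pv.
  by exists u; split=> //; rewrite /P'' lepm_refl orbT.
- by move=> m P'm; rewrite /P'' negb_or => /andP[nPm _]; apply: genP'.
move=> v w vD vw /orP[Pv|uv]; first by rewrite /P'' (domP v w).
have E : bmnm u = v by apply: lem_mdeg_eq; rewrite ?uD ?vD.
have [->|/eqP ne] := eqVneq w u; first by rewrite /P'' lepm_refl orbT.
by rewrite /P'' domu // E.
Qed.

End MonomialResolutions.

(** * The reverse lexicographic order through partial sums *)

Section RevLex.
Variable n : nat.
Implicit Types m u v w : 'X_{1..n}.

Lemma last_difference (p q : nat -> nat) N :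
    (exists2 t, (t <= N)%N & p t != q t) ->
  exists k, [/\ (k <= N)%N, p k != q k & forall t, (k < t <= N)%N -> p t = q t].
Proof.
elim: N => [|N IH] [t tN ptq].
  by exists 0%N; move: tN ptq; rewrite leqn0 => /eqP ->; split=> // t'; lia.
have [E|E] := eqVneq (p N.+1) (q N.+1); last first.
  by exists N.+1; split=> // t'; lia.
have [|k [kN kE kt]] := IH.
  exists t => //; rewrite -ltnS ltn_neqAle tN andbT; apply: contraNneq ptq => ->.
  by rewrite E.
exists k; split=> //; first exact: leqW.
move=> t' /andP[kt']; rewrite leq_eqVlt => /orP[/eqP ->//|t'N].
by apply: kt; rewrite kt'.
Qed.

(* The degree comparison is the case k = n. *)
Lemma revlex_ltP u v : revlex_lt u v <->
  exists k, [/\ (k <= n)%N, (psum k u < psum k v)%N &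
                forall t, (k < t <= n)%N -> psum t u = psum t v].
Proof.
rewrite /revlex_lt; split.
  case/orP=> [lt|/andP[/eqP E /existsP[k /andP[vu /forallP tl]]]].
    by exists n; rewrite !psum_mdeg //; split=> // t; lia.
  have eqt d t : (t + d = n)%N -> (k < t)%N -> psum t u = psum t v.
    elim: d t => [|d IH] t.
      by rewrite addn0 => -> _; rewrite !psum_mdeg.
    move=> tn kt; have tn' : (t < n)%N by lia.
    have := IH t.+1 _ (leqW kt); rewrite addSnnS => /(_ tn).
    rewrite -[t]/(nat_of_ord (Ordinal tn')) !psumS /=.
    by have /implyP/(_ kt)/eqP -> := tl (Ordinal tn') => /addIn.
  exists k; split; [exact: ltnW| |by move=> t /andP[kt tn]; apply: (eqt (n - t)%N); lia].
  have := eqt (n - k.+1)%N k.+1; rewrite !psumS subnKC // => /(_ erefl (ltnSn k)).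
  lia.
case=> k [kn lt eqt]; move: kn; rewrite leq_eqVlt => /orP[/eqP kn|kn].
  by move: lt; rewrite kn !psum_mdeg // => ->.
have E : mdeg u = mdeg v by have := eqt n; rewrite !psum_mdeg // => -> //; rewrite kn leqnn.
apply/orP; right; rewrite E eqxx; apply/existsP; exists (Ordinal kn) => /=.
apply/andP; split.
  have := eqt k.+1; rewrite ltnSn kn => /(_ isT).
  by rewrite -[k]/(nat_of_ord (Ordinal kn)) !psumS /=; lia.
apply/forallP => l; apply/implyP => kl.
have := eqt l.+1; rewrite ltnW //= ltn_ord => /(_ isT).
rewrite !psumS; have -> := eqt l; last by rewrite kl ltnW.
by move=> /addnI ->.
Qed.

Lemma revlex_lt_irr u : ~~ revlex_lt u u.
Proof. by apply/negP => /revlex_ltP[k [_]]; rewrite ltnn. Qed.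

Lemma revlex_lt_trans v u w : revlex_lt u v -> revlex_lt v w -> revlex_lt u w.
Proof.
move=> /revlex_ltP[k [kn uv eqk]] /revlex_ltP[l [ln vw eql]]; apply/revlex_ltP.
have [kl|lk] := ltnP k l.
  exists l; split=> //; first by rewrite eqk // kl ln.
  by move=> t /andP[lt tn]; rewrite eqk ?eql ?lt ?(ltn_trans kl lt).
exists k; split=> //.
  move: lk; rewrite leq_eqVlt => /orP[/eqP lk|lk]; first by rewrite -lk in uv *; lia.
  by rewrite -eql // lk.
by move=> t /andP[kt tn]; rewrite eqk ?eql ?kt ?(leq_ltn_trans lk kt).
Qed.

Lemma revlex_lt_total u v : u != v -> revlex_lt u v || revlex_lt v u.
Proof.
move=> ne; have [|k [kn kE kt]] := @last_difference (fun t => psum t u) (fun t => psum t v) n.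
  have [[t ht]|none] := pselect (exists t : nat, (t <= n)%N && (psum t u != psum t v)).
    by case/andP: ht; exists t.
  case/eqP: ne; apply: psum_inj => t; have [tn|/ltnW nt] := leqP t n.
    by apply: contra_notP none => /eqP E; exists t; rewrite tn.
  rewrite !(psum_mdeg _ nt) -!(psum_mdeg _ (leqnn n)).
  by apply: contra_notP none => /eqP E; exists n; rewrite leqnn.
move: kE; rewrite neq_ltn => /orP[] lt; apply/orP; [left|right];
  apply/revlex_ltP; exists k; split=> // t /kt //.
Qed.

(** The last differing partial sum decides the reverse lexicographic order, and dominance fixes its
    direction. *)
Lemma dom_revlex u v : dom u v -> u != v -> revlex_lt u v.
Proof.
move=> uv /revlex_lt_total/orP[//|/revlex_ltP[k [_ lt _]]].
by case: uv => _ /(_ k); rewrite leqNgt lt.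
Qed.

End RevLex.

(** * Leading monomials and spans of monomials *)

Section Leads.
Variables (n : nat) (K : fieldType).
Local Notation A := {mpoly K[n]}.
Implicit Types (f : A) (m : 'X_{1..n}).

Lemma revlex_lead_uniq f m m' : revlex_lead f m -> revlex_lead f m' -> m = m'.
Proof.
move=> [mf mP] [m'f m'P]; apply/eqP; apply: contraT => ne.
have := m'P _ mf ne => /revlex_lt_trans h; rewrite eq_sym in ne.
by have /h := mP _ m'f ne; rewrite (negbTE (revlex_lt_irr _)).
Qed.

Lemma revlex_lead_ex f : f != 0 -> exists m, revlex_lead f m.
Proof.
rewrite -msupp_eq0 /revlex_lead; elim: (msupp f) => // m s IH _.
have [->|/IH [u [us uP]]] := eqVneq s [::].
  by exists m; rewrite mem_head; split=> // m'; rewrite inE => /eqP ->; rewrite eqxx.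
have [->|ne] := eqVneq m u.
  exists u; rewrite mem_head; split=> // m'; rewrite inE.
  by case: (eqVneq m' u) => //= ne m's _; apply: uP.
have [mu|mu] := boolP (revlex_lt m u).
  exists u; rewrite inE us orbT; split=> // m'; rewrite inE => /orP[/eqP -> //|].
  exact: uP.
have {}mu : revlex_lt u m.
  by have := revlex_lt_total ne; rewrite (negbTE mu).
exists m; rewrite mem_head; split=> // m'; rewrite inE; case: (eqVneq m' m) => //= _ m's _.
have [->//|ne'] := eqVneq m' u.
by apply: revlex_lt_trans mu; apply: uP.
Qed.

Lemma ideal_gen_monomials (P : pred 'X_{1..n}) : upclosed P ->
  ideal_gen [set ('X_[m] : A) | m in [set m | P m]]%classic = mspan P.
Proof.
move=> upP; apply/seteqP; split=> f /=.
  case=> r [c [g [gP ->]]] m /msupp_sum_le /flatten_mapP[k _].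
  have [u Pu <-] := gP k; rewrite (perm_mem (msuppMX _ _)) => /mapP[m' _ ->].
  by apply: upP Pu; apply: lem_addr.
move=> fP; exists (size (msupp f)), (fun k => f@_(nth 0%MM (msupp f) k) *: 1),
  (fun k => 'X_[nth 0%MM (msupp f) k]); split=> [k|].
  by exists (nth 0%MM (msupp f) k) => //; apply/fP/mem_nth.
rewrite {1}[f]mpolyE (big_nth 0%MM) big_mkord; apply: eq_bigr => k _.
by rewrite -scalerAl mul1r.
Qed.

Lemma mspan_lin (P : pred 'X_{1..n}) (c : K) (f g : A) :
  mspan P f -> mspan P g -> mspan P (c *: f + g).
Proof.
move=> fP gP m /msuppD_le; rewrite mem_cat => /orP[/msuppZ_le|]; [exact: fP|exact: gP].
Qed.

Lemma mspanX (P : pred 'X_{1..n}) m : P m -> mspan P ('X_[m] : A).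
Proof. by move=> Pm m'; rewrite msuppX inE => /eqP ->. Qed.

Lemma mspan_ind (P : pred 'X_{1..n}) (Q : A -> Prop) :
    Q 0 -> (forall c f g, Q f -> Q g -> Q (c *: f + g)) ->
    (forall m, P m -> Q 'X_[m]) ->
  forall f, mspan P f -> Q f.
Proof.
move=> Q0 QD QX f fP; rewrite [f]mpolyE big_seq.
by elim/big_rec: _ => // m g mf Qg; apply: QD => //; apply/QX/fP.
Qed.

End Leads.

(** * Linear substitutions *)

Section LinSubst.
Variables (n : nat) (K : fieldType).
Local Notation A := {mpoly K[n]}.
Implicit Types (f g : A) (m : 'X_{1..n}) (h : 'M[K]_n).

Lemma lin_substD h : {morph lin_subst h : f g / f + g}.
Proof. by move=> f g; rewrite /lin_subst comp_mpolyD. Qed.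

Lemma lin_subst0 h : lin_subst h 0 = 0.
Proof. exact: comp_mpoly0. Qed.

Lemma lin_substZ h c f : lin_subst h (c *: f) = c *: lin_subst h f.
Proof. exact: comp_mpolyZ. Qed.

Lemma lin_subst_sum h (I : Type) (r : seq I) P (F : I -> A) :
  lin_subst h (\sum_(k <- r | P k) F k) = \sum_(k <- r | P k) lin_subst h (F k).
Proof. exact: raddf_sum. Qed.

Lemma lin_substM h : {morph lin_subst h : f g / f * g}.
Proof. by move=> f g; rewrite /lin_subst rmorphM. Qed.

Lemma lin_substXn h f e : lin_subst h (f ^+ e) = lin_subst h f ^+ e.
Proof. by rewrite /lin_subst rmorphXn. Qed.

Lemma lin_substX h m :
  lin_subst h 'X_[m] = \prod_(k < n) (\sum_l h l k *: 'X_l) ^+ m k.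
Proof.
rewrite /lin_subst comp_mpolyX; apply: eq_bigr => k _.
by rewrite tnth_mktuple.
Qed.

Lemma lin_substU h (k : 'I_n) : lin_subst h 'X_k = \sum_l h l k *: 'X_l.
Proof. by rewrite /lin_subst comp_mpolyXU -tnth_nth tnth_mktuple. Qed.

Lemma lin_subst_mul h h' f : lin_subst h (lin_subst h' f) = lin_subst (h *m h') f.
Proof.
rewrite [f]mpolyE (lin_subst_sum h') (lin_subst_sum h) lin_subst_sum; apply: eq_bigr => m _.
rewrite !lin_substZ; congr (_ *: _); rewrite !lin_substX.
rewrite [LHS]rmorph_prod; apply: eq_bigr => k _ /=.
rewrite rmorphXn /=; congr (_ ^+ _).
rewrite -[LHS]/(lin_subst h (\sum_l h' l k *: 'X_l)) (lin_subst_sum h).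
rewrite (eq_bigr (fun l => \sum_s h' l k *: (h s l *: 'X_s))); last first.
  by move=> l _; rewrite lin_substZ lin_substU scaler_sumr.
rewrite exchange_big; apply: eq_bigr => l _ /=.
rewrite mxE scaler_suml; apply: eq_bigr => s _.
by rewrite scalerA mulrC.
Qed.

Lemma lin_subst1 f : lin_subst 1%:M f = f.
Proof.
rewrite -[RHS]comp_mpoly_id /lin_subst; congr comp_mpoly; apply: eq_mktuple => k.
rewrite (bigD1 k) //= mxE eqxx scale1r big1 ?addr0 // => l /negbTE lk.
by rewrite mxE lk scale0r.
Qed.

Lemma lin_substK h : h \in unitmx -> cancel (lin_subst h) (lin_subst (invmx h)).
Proof. by move=> hu f; rewrite lin_subst_mul mulVmx // lin_subst1. Qed.

Lemma lin_substVK h : h \in unitmx -> cancel (lin_subst (invmx h)) (lin_subst h).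
Proof. by move=> hu f; rewrite lin_subst_mul mulmxV // lin_subst1. Qed.

(** Any additive relation that holds between each variable and the variables of its image propagates
    to monomials. It is applied to dominance and to its converse. *)
Lemma msupp_lin_subst (R : rel 'X_{1..n}) h :
    R 0%MM 0%MM ->
    (forall m m' u u', R m u -> R m' u' -> R (m + m')%MM (u + u')%MM) ->
    (forall k l, h l k != 0 -> R U_(k)%MM U_(l)%MM) ->
  forall m u, u \in msupp (lin_subst h 'X_[m]) -> R m u.
Proof.
move=> R0 RD hR m; rewrite lin_substX.
pose S (f : A) m := forall u, u \in msupp f -> R m u.
have S1 : S 1 0%MM by move=> u; rewrite msupp1 inE => /eqP ->.
have SM f g u v : S f u -> S g v -> S (f * g) (u + v)%MM.
  move=> Sf Sg w /msuppM_le /allpairsP[[w1 w2] /= [/Sf h1 /Sg h2 ->]].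
  exact: RD.
suff : S (\prod_(k < n) (\sum_l h l k *: 'X_l) ^+ m k) (\sum_(k < n) U_(k) *+ m k)%MM.
  by rewrite -multinomUE_id.
apply: (big_ind2 S) => [|f u g v|k _]; [exact: S1 | exact: SM |].
elim: (m k) => [|e IH]; first by rewrite expr0 mulm0n.
rewrite exprS mulmS; apply: SM IH => u.
move=> /msupp_sum_le /flatten_mapP[l _]; rewrite mcoeff_msupp mcoeffZ mcoeffX.
by case: (eqVneq U_(l)%MM u) => [<-|_]; rewrite ?mulr0 ?eqxx // mulr1; apply: hR.
Qed.

(** Column [k] of [h] is the image of the variable of index [k]. Thus [upper] substitutions use
    earlier variables and move monomials up in dominance, [lower] ones move them down. *)
Definition upper h := forall k l : 'I_n, (k < l)%N -> h l k = 0.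
Definition lower h := forall k l : 'I_n, (l < k)%N -> h l k = 0.

Lemma upper_supp h m u : upper h -> u \in msupp (lin_subst h 'X_[m]) -> dom m u.
Proof.
move=> hu /(@msupp_lin_subst (fun m u => `[< dom m u >])) H; apply/asboolP/H.
- exact/asboolP/dom_refl.
- by move=> a b c d /asboolP ab /asboolP cd; apply/asboolP/domD.
move=> k l hlk; apply/asboolP/dom_U; rewrite leqNgt; apply: contra_neqN hlk.
exact: hu.
Qed.

Lemma lower_supp h m u : lower h -> u \in msupp (lin_subst h 'X_[m]) -> dom u m.
Proof.
move=> hu /(@msupp_lin_subst (fun m u => `[< dom u m >])) H; apply/asboolP/H.
- exact/asboolP/dom_refl.
- by move=> a b c d /asboolP ab /asboolP cd; apply/asboolP/domD.
move=> k l hlk; apply/asboolP/dom_U; rewrite leqNgt; apply: contra_neqN hlk.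
exact: hu.
Qed.

Lemma upper_diag h k : h \in unitmx -> upper h -> h k k != 0.
Proof.
rewrite unitmxE unitfE => hu uh; move: hu; rewrite -det_tr det_trig; last first.
  by apply/is_trig_mxP => a b ab; rewrite mxE uh.
by move=> /prodf_neq0/(_ k isT); rewrite mxE.
Qed.

Lemma invmx_upper h : h \in unitmx -> upper h -> upper (invmx h).
Proof.
move=> hu uh.
have diag k := upper_diag k hu uh.
(* Induction on the column: once the earlier columns of the inverse vanish below the diagonal, the
   entry [(l, k)] of [invmx h *m h] is [invmx h l k * h k k]. *)
have step N (k l : 'I_n) : (k < N)%N -> (k < l)%N -> invmx h l k = 0.
  elim: N k => // N IH k; rewrite ltnS => kN kl.
  have /matrixP/(_ l k) := mulVmx hu; rewrite !mxE.
  rewrite (bigD1 k) //= big1 => [|s sk].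
    rewrite addr0 (_ : (l == k) = false) => [/eqP|]; last first.
      by rewrite -val_eqE /=; lia.
    by rewrite mulr0n mulf_eq0 (negbTE (diag k)) orbF => /eqP.
  have [ks|ks] := ltnP k s; first by rewrite uh // mulr0.
  have sk' : (s < k)%N by rewrite ltn_neqAle ks andbT.
  by rewrite IH ?mul0r //; [apply: leq_trans kN | apply: ltn_trans kl].
by move=> k l; apply: (step k.+1).
Qed.

Lemma invmx_lower h : h \in unitmx -> lower h -> lower (invmx h).
Proof.
move=> hu lh k l lk; have := @invmx_upper h^T; rewrite unitmx_tr hu => /(_ isT) H.
have -> : invmx h = (invmx h^T)^T by rewrite trmx_inv trmxK.
by rewrite mxE H // => a b ab; rewrite mxE lh.
Qed.

Lemma msupp_lin_subst_lt h f m : lower h ->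
  (forall u, u \in msupp f -> (u == m) || revlex_lt u m) ->
  forall u, u \in msupp (lin_subst h f) -> (u == m) || revlex_lt u m.
Proof.
move=> lh fP u; rewrite {1}[f]mpolyE lin_subst_sum => /msupp_sum_le/flatten_mapP[w].
rewrite mem_filter => /andP[_ wf]; rewrite lin_substZ => /msuppZ_le /(lower_supp lh) uw.
have [->|ne] := eqVneq u w; first exact: fP.
have /orP[/eqP <-|wm] := fP w wf; first by rewrite dom_revlex ?orbT.
by rewrite (revlex_lt_trans (dom_revlex uw ne) wm) orbT.
Qed.

Lemma msupp_lin_subst_lts h f m : lower h ->
  (forall u, u \in msupp f -> revlex_lt u m) ->
  forall u, u \in msupp (lin_subst h f) -> revlex_lt u m.
Proof.
move=> lh fP u; rewrite {1}[f]mpolyE lin_subst_sum => /msupp_sum_le/flatten_mapP[w].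
rewrite mem_filter => /andP[_ wf]; rewrite lin_substZ => /msuppZ_le /(lower_supp lh) uw.
have [->|ne] := eqVneq u w; first exact: fP.
exact: revlex_lt_trans (dom_revlex uw ne) (fP _ wf).
Qed.

(** The image is supported at or below [m]. If [m] itself cancelled, the inverse, again lower
    triangular, would send the image back to something supported strictly below [m]. *)
Lemma lower_lead h f m : h \in unitmx -> lower h ->
  revlex_lead f m -> revlex_lead (lin_subst h f) m.
Proof.
move=> hu lh [mf mP].
have leP : forall u, u \in msupp f -> (u == m) || revlex_lt u m.
  by move=> u uf; case: eqVneq => //= ne; apply: mP.
have le := msupp_lin_subst_lt lh leP.
split=> [|u uf ne]; last by have := le _ uf; rewrite (negbTE ne).
apply: contraT => nm; have lt u : u \in msupp (lin_subst h f) -> revlex_lt u m.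
  by move=> uf; have /orP[/eqP E|//] := le u uf; rewrite -E uf in nm.
have := msupp_lin_subst_lts (invmx_lower hu lh) lt.
by rewrite lin_substK // => /(_ m mf); rewrite (negbTE (revlex_lt_irr m)).
Qed.

End LinSubst.

(** * Generic coordinates *)

(** Restrict both polynomials to the line through [v] and [w]. The restrictions are nonzero at the
    parameters 0 and 1, and their product has finitely many roots while the integers are distinct in
    [K]. *)
Lemma mpoly_common_nonzero (K : fieldType) (N : nat) (p q : {mpoly K[N]})
    (v w : 'I_N -> K) : [pchar K] =i pred0 ->
  p.@[v] != 0 -> q.@[w] != 0 -> exists z, p.@[z] != 0 /\ q.@[z] != 0.
Proof.
move=> /pcharf0P K0 pv qw.
pose h k : {poly K} := (v k)%:P + (w k - v k) *: 'X.
pose line (r : {mpoly K[N]}) : {poly K} := mmap (@polyC K) h r.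
have lineE r t : (line r).[t] = r.@[fun k => v k + (w k - v k) * t].
  rewrite /line /mmap horner_sum mevalE; apply: eq_bigr => m _.
  rewrite hornerM hornerC /mmap1 horner_prod; congr (_ * _).
  by apply: eq_bigr => k _; rewrite horner_exp /h !hornerE.
have p0 : line p != 0.
  apply: contraNneq pv => E; have := lineE p 0; rewrite E horner0 => /esym/eqP.
  by congr (_ == _); apply: meval_eq => k; rewrite mulr0 addr0.
have q0 : line q != 0.
  apply: contraNneq qw => E; have := lineE q 1; rewrite E horner0 => /esym/eqP.
  by congr (_ == _); apply: meval_eq => k; rewrite mulr1 addrC subrK.
have pq0 : line p * line q != 0 by rewrite mulf_neq0.
pose rs := [seq m%:R : K | m <- iota 0 (size (line p * line q))].
have [t trs /negP ht] : exists2 t, t \in rs & ~ root (line p * line q) t.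
  apply: contrapT => none.
  have /(max_poly_roots pq0) : all (root (line p * line q)) rs.
    by apply/allP => t trs; apply: contraT => /negP ht; case: none; exists t.
  rewrite map_inj_uniq ?iota_uniq; last first.
    move=> a b /eqP; wlog ab : a b / (a <= b)%N.
      move=> W; case/orP: (leq_total a b) => [/W//|/W H E]; rewrite -H //.
      by rewrite eq_sym.
    rewrite eq_sym -subr_eq0 -natrB // K0 subn_eq0 => ba.
    by apply/eqP; rewrite eqn_leq ab.
  by rewrite size_map size_iota ltnn => /(_ isT).
exists (fun k => v k + (w k - v k) * t).
move: ht; rewrite /root hornerM mulf_eq0 negb_or !lineE.
by case/andP.
Qed.

Section Generic.
Variables (n : nat) (K : fieldType).
Implicit Types g h : 'M[K]_n.

Definition generic_mx : 'M[{mpoly K[n * n]}]_n := \matrix_(s, t) 'X_(mxvec_index s t).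

Definition coords g (k : 'I_(n * n)) : K := mxvec g 0 k.

Lemma generic_mxE g : map_mx (meval (coords g)) generic_mx = g.
Proof. by apply/matrixP => s t; rewrite !mxE mevalXU /coords mxvecE. Qed.

Lemma is_gin_uniq (I J J' : set {mpoly K[n]}) : [pchar K] =i pred0 ->
  is_gin I J -> is_gin I J' -> J = J'.
Proof.
move=> K0 [U [[P ->] [g [gu [p Pp pg]]] UJ]] [U' [[P' ->] [g' [_ [p' Pp' pg']]] UJ']].
(* The determinant is included so that the common point is an invertible matrix. *)
have pdet : (p * \det generic_mx).@[coords g] != 0.
  by rewrite mevalM mulf_neq0 // -det_map_mx generic_mxE -unitfE -unitmxE.
have [z [z1 z2]] := mpoly_common_nonzero K0 pdet pg'.
pose h : 'M[K]_n := vec_mx (\row_k z k).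
have zE q : q.@[coords h] = q.@[z].
  by apply: meval_eq => k; rewrite /coords vec_mxK mxE.
move: z1; rewrite -zE mevalM mulf_eq0 negb_or -det_map_mx generic_mxE => /andP[z1 hu].
have {}hu : h \in unitmx by rewrite unitmxE unitfE.
rewrite -(UJ h); last by split=> //; exists p.
by apply: UJ'; split=> //; exists p' => //; rewrite -/(coords h) zE.
Qed.

Lemma Gin_eq (I J : set {mpoly K[n]}) : [pchar K] =i pred0 -> is_gin I J -> Gin I = J.
Proof.
move=> K0 IJ; rewrite /Gin; case: xgetP => [J' _ IJ'|/(_ J)//].
exact: is_gin_uniq IJ' IJ.
Qed.

(* The leading r x r block of g, completed by an identity block. *)
Definition pad (R : pzRingType) r (g : 'M[R]_n) : 'M[R]_n :=
  \matrix_(s, t) if (s < r)%N && (t < r)%N then g s t else (s == t)%:R.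

Lemma pad_kernel r g (v : 'rV[K]_n) : pad r g \in unitmx ->
    (forall t : 'I_n, (r <= t)%N -> v 0 t = 0) ->
    (forall t : 'I_n, (t < r)%N -> (v *m g) 0 t = 0) -> v = 0.
Proof.
move=> pu v0 vg; apply: (can_inj (mulmxK pu)); rewrite mul0mx.
apply/rowP => t; rewrite !mxE; have [tr|rt] := ltnP t r.
  rewrite -[RHS](vg t tr) mxE; apply: eq_bigr => s _; rewrite mxE tr andbT.
  by case: ltnP => // rs; rewrite v0 ?mul0r.
rewrite (bigD1 t) //= v0 // mul0r add0r big1 // => s st.
by rewrite mxE ltnNge [(t < r)%N]ltnNge rt andbF (negbTE st) mulr0.
Qed.

(** Gaussian elimination without pivoting: row [r] of [L] is the unit vector plus a combination of
    the earlier ones, found by solving a system with the leading [r] x [r] block of [g]. *)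
Lemma lower_elimination g : (forall r : 'I_n, pad r g \in unitmx) ->
  exists L : 'M[K]_n, [/\ lower L, forall k, L k k = 1 & upper (L *m g)].
Proof.
move=> gu; pose v (r : 'I_n) := (\row_t (if (t < r)%N then - g r t else 0)) *m invmx (pad r g).
have vE r : v r *m pad r g = \row_t (if (t < r)%N then - g r t else 0).
  by rewrite mulmxKV.
have v0 (r t : 'I_n) : (r <= t)%N -> v r 0 t = 0.
  move=> rt; have /rowP/(_ t) := vE r; rewrite mxE [RHS]mxE ltnNge rt /=.
  rewrite (bigD1 t) //= big1 => [|s st].
    by rewrite [pad r g t t]mxE ltnNge rt /= eqxx mulr1 addr0.
  by rewrite [pad r g s t]mxE [(t < r)%N]ltnNge rt andbF (negbTE st) mulr0.
exists (\matrix_(r, s) (v r 0 s + (r == s)%:R)); split.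
- move=> k l lk; rewrite mxE v0 ?(ltnW lk) // -val_eqE /=.
  by rewrite (_ : _ == _ = false) ?addr0 //; lia.
- by move=> k; rewrite mxE v0 // eqxx add0r.
move=> t r tr; rewrite mxE.
under eq_bigr do rewrite mxE mulrDl.
rewrite big_split /= [X in _ + X](bigD1 r) //= eqxx mul1r [X in _ + (_ + X)]big1; last first.
  by move=> s sr; rewrite eq_sym (negbTE sr) mul0r.
have /rowP/(_ t) := vE r; rewrite mxE [RHS]mxE tr => E.
rewrite addr0 (_ : \sum_i v r 0 i * g i t = - g r t) ?addNr // -E.
apply: eq_bigr => s _; rewrite [pad r g s t]mxE tr andbT; case: ltnP => // rs.
by rewrite v0 ?mul0r.
Qed.

Lemma generic_elimination g (k l : 'I_n) : g \in unitmx -> (k < l)%N ->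
    (forall r : 'I_n, pad r g \in unitmx) -> pad k.+1 (xcol k l g) \in unitmx ->
  exists L : 'M[K]_n,
    [/\ L \in unitmx, lower L, L *m g \in unitmx, upper (L *m g) & (L *m g) k l != 0].
Proof.
move=> gu kl gr gkl; have [L [Ll L1 Lg]] := lower_elimination gr.
have Lu : L \in unitmx.
  rewrite unitmxE unitfE det_trig; last first.
    by apply/is_trig_mxP => a b ab; apply: Ll.
  by apply/prodf_neq0 => a _; rewrite L1 oner_eq0.
exists L; split=> //; first by rewrite unitmx_mul Lu.
(* Otherwise row [k] of [L], supported on the first [k.+1] columns, would annihilate the first
   [k.+1] columns of [xcol k l g], contradicting the invertibility of that block. *)
apply/negP => /eqP E.
have /rowP/(_ k) : row k L = 0.
  apply: (pad_kernel gkl) => t tk; first by rewrite mxE Ll.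
  have <- : (L *m g) k (tperm k l t) = 0.
    case: tpermP => [_|tl|/eqP tk' _]; [exact: E | by rewrite tl in tk; lia|].
    by apply: Lg; rewrite ltn_neqAle tk' -ltnS.
  by rewrite !mxE; apply: eq_bigr => s _; rewrite !mxE.
by rewrite !mxE L1 => /eqP; rewrite oner_eq0.
Qed.

Lemma map_pad (R S : pzRingType) (f : {rmorphism R -> S}) r (g : 'M[R]_n) :
  map_mx f (pad r g) = pad r (map_mx f g).
Proof. by apply/matrixP => s t; rewrite !mxE; case: ifP => //; rewrite rmorph_nat. Qed.

Definition leads (J : set {mpoly K[n]}) : set 'X_{1..n} :=
  [set m | exists2 f, J f & revlex_lead f m]%classic.

Lemma leads_lower (J : set {mpoly K[n]}) L : L \in unitmx -> lower L ->
  leads (lin_subst L @` J)%classic = leads J.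
Proof.
move=> Lu Ll; apply/seteqP; split=> m [f].
  case=> f' Jf' <- fm; exists f' => //.
  have [|m' f'm'] := @revlex_lead_ex _ _ f'.
    by apply/eqP => E; case: fm; rewrite E lin_subst0 msupp0.
  by rewrite (revlex_lead_uniq fm (lower_lead Lu Ll f'm')).
move=> Jf fm; exists (lin_subst L f); first by exists f.
exact: lower_lead.
Qed.

(** For generic [g] some lower triangular [L] makes [L *m g] upper triangular, and [L] preserves
    leading monomials, so upper triangular substitutions suffice. One entry above the diagonal may
    moreover be assumed nonzero. *)
Lemma is_gin_leads (I : set {mpoly K[n]}) (P : pred 'X_{1..n}) (k l : 'I_n) :
    upclosed P -> (k < l)%N ->
    (forall U : 'M[K]_n, U \in unitmx -> upper U -> U k l != 0 ->
       leads (lin_subst U @` I)%classic = [set m | P m]%classic) ->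
  is_gin I (mspan P).
Proof.
move=> upP kl UP.
pose p : {mpoly K[n * n]} :=
  (\prod_(r < n) \det (pad r generic_mx)) * \det (pad k.+1 (xcol k l generic_mx)).
have pE g : p.@[coords g] =
    (\prod_(r < n) \det (pad r g)) * \det (pad k.+1 (xcol k l g)).
  rewrite mevalM rmorph_prod /=; congr (_ * _).
    by apply: eq_bigr => r _; rewrite -det_map_mx map_pad generic_mxE.
  by rewrite -det_map_mx map_pad map_xcol generic_mxE.
exists [set g | g \in unitmx /\ exists2 q, [set p]%classic q & q.@[coords g] != 0]%classic.
split; first by exists [set p]%classic.
  (* The identity plus the elementary matrix at [(k, l)]: all blocks involved, including the one
     with columns [k] and [l] exchanged, are unitriangular. *)
  pose g : 'M[K]_n := \matrix_(s, t) ((s == t) || (s == k) && (t == l))%:R.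
  have trig (h : 'M[K]_n) : upper h -> (forall s, h s s = 1) -> \det h = 1.
    move=> uh h1; rewrite -det_tr det_trig; last first.
      by apply/is_trig_mxP => a b ab; rewrite mxE uh.
    by apply: big1 => s _; rewrite mxE h1.
  have nkl (s t : 'I_n) : (t < s)%N -> (s == t) || (s == k) && (t == l) = false.
    by move=> ts; rewrite -!val_eqE /=; lia.
  exists g; split.
    rewrite unitmxE unitfE trig ?oner_eq0 // => [s t ts|s]; rewrite mxE ?eqxx //.
    by rewrite nkl.
  exists p => //; rewrite pE big1 ?mul1r => [|r _]; last first.
    apply: trig => [s t ts|s]; rewrite !mxE ?eqxx ?if_same //.
    by rewrite nkl // (_ : (t == s) = false) ?if_same // -val_eqE /=; lia.
  rewrite trig ?oner_eq0 // => [s t ts|s].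
    rewrite !mxE; case: ifP => [/andP[sk tk]|_]; last first.
      by rewrite -val_eqE /= (_ : (_ == _)%N = false) //; lia.
    case: tpermP => [E|E|_ _]; first by rewrite E in ts; lia.
      by rewrite E in tk; lia.
    by rewrite nkl.
  rewrite !mxE; case: ifP => [/andP[sk _]|_]; last by rewrite eqxx.
  case: tpermP => [->|E|_ _]; rewrite ?eqxx ?orbT //.
  by rewrite E in sk; lia.
move=> g [gu [q -> pg]]; rewrite pE mulf_eq0 negb_or in pg.
case/andP: pg => /prodf_neq0 gr gkl.
have gr' (r : 'I_n) : pad r g \in unitmx by rewrite unitmxE unitfE gr.
have gkl' : pad k.+1 (xcol k l g) \in unitmx by rewrite unitmxE unitfE.
have [L [Lu Ll LgU Lgu Lgkl]] := generic_elimination gu kl gr' gkl'.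
rewrite -(ideal_gen_monomials K upP) -(UP _ LgU Lgu Lgkl).
rewrite /initial_ideal -/(leads _) -(leads_lower _ Lu Ll).
suff -> : (lin_subst L @` (lin_subst g @` I) = lin_subst (L *m g) @` I)%classic by [].
rewrite image_comp; apply: eq_imagel => f _.
exact: lin_subst_mul.
Qed.

End Generic.

(** * Hilbert functions and the lexsegment ideal *)

Lemma is_basis_leq (K : fieldType) (V : lmodType K) (S : set V) r s
    (b : 'I_r -> V) (c : 'I_s -> V) : is_basis S b -> is_basis S c -> (r <= s)%N.
Proof.
move=> [bS bfree] [cS cfree].
have bc (k : 'I_r) : exists u : 'I_s -> K, b k = \sum_l u l *: c l.
  apply/cS/bS; exists (fun l => (l == k)%:R).
  rewrite (bigD1 k) //= eqxx scale1r big1 ?addr0 // => l /negbTE ->.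
  by rewrite scale0r.
have [P PE] := choice bc; pose M : 'M[K]_(r, s) := \matrix_(k, l) P k l.
suff /eqP <- : row_free M by apply: rank_leq_col.
rewrite -kermx_eq0; apply/eqP/row_matrixP => k; rewrite row0.
have : row k (kermx M) *m M = 0 by rewrite -row_mul mulmx_ker row0.
move: (row k (kermx M)) => v vM; apply/rowP => l; rewrite mxE.
apply: (bfree (fun l => v 0 l)).
under eq_bigr do rewrite PE scaler_sumr.
rewrite exchange_big /= big1 // => t _.
under eq_bigr do rewrite scalerA.
rewrite -scaler_suml; have /rowP/(_ t) := vM; rewrite !mxE.
under eq_bigr do rewrite mxE.
by move=> ->; rewrite scale0r.
Qed.

Lemma dim_set_basis (K : fieldType) (V : lmodType K) (S : set V) r (b : 'I_r -> V) :
  is_basis S b -> dim_set S = r.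
Proof.
move=> bS; rewrite /dim_set; case: xgetP => [s _ [c cS]|/(_ r) []]; last by exists b.
by apply/eqP; rewrite eqn_leq (is_basis_leq cS bS) (is_basis_leq bS cS).
Qed.

Section HilbertLex.
Variables (n : nat) (K : fieldType).
Local Notation A := {mpoly K[n]}.
Implicit Types (P Q : pred 'X_{1..n}) (m u : 'X_{1..n}).

Definition count_deg P d : nat :=
  #|[pred u : 'X_{1..n < d.+1} | (mdeg u == d) && P u]|.

Lemma hilb_mspan P d : hilb (mspan P : set A) d = count_deg P d.
Proof.
pose D := [pred u : 'X_{1..n < d.+1} | (mdeg u == d) && P u].
pose e (k : 'I_#|D|) : 'X_{1..n} := bmnm (enum_val k).
apply: (@dim_set_basis _ _ _ _ (fun k => 'X_[e k] : A)).
have DP k : mdeg (e k) = d /\ P (e k).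
  by have /andP[/eqP] := enum_valP k.
split=> [f|c E k]; last first.
  have := congr1 (mcoeff (e k)) E; rewrite mcoeff0 raddf_sum /=.
  rewrite (bigD1 k) //= mcoeffZ mcoeffX eqxx mulr1 big1 ?addr0 // => l lk.
  rewrite mcoeffZ mcoeffX; case: eqVneq => [E'|_]; last by rewrite mulr0.
  by case/eqP: lk; apply/enum_val_inj/val_inj.
split=> [[fP fd]|[c ->]]; last first.
  split=> [m /msupp_sum_le/flatten_mapP[k _] /msuppZ_le|].
    by rewrite msuppX inE => /eqP ->; case: (DP k).
  apply/dhomogP => m /msupp_sum_le/flatten_mapP[k _] /msuppZ_le.
  by rewrite msuppX inE => /eqP ->; case: (DP k).
exists (fun k => f@_(e k)); apply/mpolyP => m; rewrite raddf_sum /=.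
under eq_bigr do rewrite mcoeffZ mcoeffX.
have [mf|mf] := boolP (m \in msupp f); last first.
  rewrite (memN_msupp_eq0 mf) big1 // => k _; case: eqVneq => [->|_].
    by rewrite (memN_msupp_eq0 mf) mul0r.
  by rewrite mulr0.
have md : mdeg m = d by move/dhomogP: fd => /(_ m mf).
have mb : (mdeg m < d.+1)%N by rewrite md.
have mD : BMultinom mb \in D by rewrite inE /= md eqxx fP.
rewrite (bigD1 (enum_rank_in mD (BMultinom mb))) //= /e enum_rankK_in //= eqxx mulr1.
rewrite big1 ?addr0 // => k km; case: eqVneq => [E|_]; last by rewrite mulr0.
case/eqP: km; apply: enum_val_inj; rewrite enum_rankK_in //.
exact: val_inj.
Qed.

(** A monomial outside a lexsegment has the whole segment above it; for a monomial inside,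
    everything above it belongs to the segment, which contains one monomial more. *)
Lemma Lex_mspan (I : set A) Q : (forall d, hilb I d = count_deg Q d) ->
    (forall m u, mdeg m = mdeg u -> (m < u)%O -> Q m -> Q u) ->
  Lex I = mspan Q.
Proof.
move=> hI Qup; have lexE m : lex_mon I m <-> Q m.
  rewrite /lex_mon /= hI /count_deg; split=> [lt|Qm].
    apply: contraTT lt => nQm; rewrite -leqNgt; apply: subset_leq_card.
    apply/fintype.subsetP => u; rewrite !inE => /andP[/eqP um Qu].
    rewrite um eqxx /= ltNge; apply: contra nQm; rewrite le_eqVlt => /orP[/eqP E|lt].
      by rewrite -E.
    exact: Qup lt Qu.
  have mb : (mdeg m < (mdeg m).+1)%N by [].
  apply: proper_card; apply/properP; split.
    apply/fintype.subsetP => u; rewrite !inE => /andP[/eqP um lt].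
    by rewrite um eqxx /=; apply: Qup lt Qm.
  by exists (BMultinom mb); rewrite !inE /= eqxx ?Qm //= ltxx.
by apply/seteqP; split=> f fL m /fL; [move=> /lexE|move=> Qm; apply/lexE].
Qed.

Lemma lt_psum m u : mdeg m = mdeg u -> (m < u)%O ->
  exists2 k : nat, (forall t, (t <= k)%N -> psum t m = psum t u) &
    (psum k.+1 m < psum k.+1 u)%N.
Proof.
move=> E /(ltmcP E)[k eqk ltk].
have eqp t : (t <= k)%N -> psum t m = psum t u.
  by move=> tk; apply: eq_bigr => l lt; apply: eqk; apply: leq_trans tk.
by exists k => //; rewrite !psumS eqp // ltn_add2l.
Qed.

Lemma count_deg_swap P Q a b d : mdeg a = d -> mdeg b = d ->
    (forall m, mdeg m = d -> P m -> m != a -> Q m) ->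
    (forall m, mdeg m = d -> Q m -> m != b -> P m) ->
    P a -> ~~ Q a -> Q b -> ~~ P b ->
  count_deg P d = count_deg Q d.
Proof.
move=> ad bd PQ QP Pa nQa Qb nPb; rewrite /count_deg.
have ab : (mdeg a < d.+1)%N by rewrite ad.
have bb : (mdeg b < d.+1)%N by rewrite bd.
rewrite -!sum1_card (bigD1 (BMultinom ab)) /=; last by rewrite unfold_in /= ad eqxx.
rewrite [RHS](bigD1 (BMultinom bb)) /=; last by rewrite unfold_in /= bd eqxx.
congr (_ + _)%N; apply: eq_bigl => u.
suff : ((mdeg u == d) && P u) && (bmnm u != a) =
       ((mdeg u == d) && Q u) && (bmnm u != b) by [].
case: (eqVneq (bmnm u) a) => [->|ua] /=; first by rewrite (negbTE nQa) !andbF.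
case: (eqVneq (bmnm u) b) => [->|ub] /=; first by rewrite (negbTE nPb) !andbF.
rewrite !andbT; case: eqP => //= ud; apply/idP/idP => [Pu|Qu]; first exact: PQ.
exact: QP.
Qed.

Lemma eq_count_deg P Q d : (forall m, mdeg m = d -> P m = Q m) ->
  count_deg P d = count_deg Q d.
Proof.
by move=> PQ; apply: eq_card => u; rewrite !inE; case: eqP => //= /PQ ->.
Qed.

End HilbertLex.

(** * The three monomial ideals and their Betti numbers *)

(** The inequality says that m / u is not a monomial in the first [q0] variables alone, so some
    later variable divides it. This turns membership in a chain into partial sums. *)
Lemma psum_lt_chain n (u m : 'X_{1..n}) q0 :
    (u <= m)%MM -> (psum q0 m + mdeg u < mdeg m + psum q0 u)%N ->
  [exists q : 'I_n, (q0 <= q)%N && (u + U_(q) <= m)%MM].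
Proof.
move=> um; rewrite -{1 2}(submK um) psumD mdegD => lt.
apply: contraLR lt => /existsPn nq; rewrite -leqNgt.
suff : (mdeg (m - u) <= psum q0 (m - u))%N by lia.
rewrite mdegE /psum [leqRHS]big_mkcond /=; apply: leq_sum => l _.
have := nq l; case: ltnP => //= ql; apply: contraR; rewrite -ltnNge => lt.
apply/mnm_lepP => k; rewrite mnmDE mnm1E; have := mnm_lepP um k.
by case: eqP => [<-|_]; rewrite ?addn0 // mnmBE in lt *; lia.
Qed.

Section Construction.
Variables (n i j : nat).
Hypotheses (hi : (2 <= i <= n)%N) (hj : (3 <= j <= n)%N).
Implicit Types m w : 'X_{1..n}.

Fact var1_subproof : (0 < n)%N. Proof. lia. Qed.
Fact var2_subproof : (1 < n)%N. Proof. lia. Qed.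
Fact vari1_subproof : (i - 2 < n)%N. Proof. lia. Qed.
Fact vari_subproof : (i - 1 < n)%N. Proof. lia. Qed.
Fact varj_subproof : (j - 1 < n)%N. Proof. lia. Qed.
Definition x1 := Ordinal var1_subproof.
Definition x2 := Ordinal var2_subproof.
Definition xi1 := Ordinal vari1_subproof.
Definition xi := Ordinal vari_subproof.
Definition xj := Ordinal varj_subproof.

(* The monomials x_1^2 x_i^2, x_1^2 x_(i-1) x_i, x_2^5 and x_1 x_2^3 x_j. *)
Definition ma : 'X_{1..n} := (U_(x1) *+ 2 + U_(xi) *+ 2)%MM.
Definition mb : 'X_{1..n} := (U_(x1) *+ 2 + U_(xi1) + U_(xi))%MM.
Definition mc : 'X_{1..n} := (U_(x2) *+ 5)%MM.
Definition md : 'X_{1..n} := (U_(x1) + U_(x2) *+ 3 + U_(xj))%MM.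

(* In degree 4: x_1^2 (x_1, ..., x_(i-2)) (x_1, ..., x_n) and x_1^2 x_(i-1)^2. *)
Definition base m : bool :=
  [&& (4 <= mdeg m)%N, (2 <= psum 1 m)%N &
      (3 <= psum (i - 2) m)%N || (4 <= psum (i - 1) m)%N].
(** In degree 4 this is the lexsegment ending at x_1^2 x_(i-1) x_i. *)
Definition base_b m : bool :=
  [&& (4 <= mdeg m)%N, (2 <= psum 1 m)%N &
      (3 <= psum (i - 2) m)%N || ((3 <= psum (i - 1) m) && (4 <= psum i m))%N].
(* The degree 5 part of the ideal generated by base and ma, enlarged by the
   x_1^2 x_(i-1) x_i x_p with p > i. *)
Definition quint m : bool :=
  (2 <= psum 1 m)%N && ((3 <= psum (i - 2) m)%N || (4 <= psum i m)%N).
(* In degree 5: x_1^2 A_3 and the x_1 x_2^3 x_p with p < j. *)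
Definition low m : bool :=
  (2 <= psum 1 m)%N ||
  [&& (1 <= psum 1 m)%N, (4 <= psum 2 m)%N & (5 <= psum (j - 1) m)%N].
Definition low_c m : bool := low m || (5 <= psum 2 m)%N.
(** In degree 5 this is the lexsegment ending at x_1 x_2^3 x_j. *)
Definition low_d m : bool :=
  (2 <= psum 1 m)%N || [&& (1 <= psum 1 m)%N, (4 <= psum 2 m)%N & (5 <= psum j m)%N].
(** The condition met from degree 6 on, whichever of x_2^5 and x_1 x_2^3 x_j is added as a generator
    before the multiples of the other. *)
Definition low_cd m : bool := low_d m || (5 <= psum 2 m)%N.

Definition core m : bool :=
  [|| base m, (5 <= mdeg m)%N && low_c m | (6 <= mdeg m)%N].
Definition monI m : bool := core m || (m == ma).
Definition monGin m : bool := core m || (m == mb).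
Definition monLex m : bool :=
  [|| base_b m, (5 <= mdeg m)%N && low_d m | (6 <= mdeg m)%N].

Lemma coord m (l : 'I_n) : m l = (psum l.+1 m - psum l m)%N.
Proof. by rewrite psumS addKn. Qed.

Lemma coord1 m : m x1 = psum 1 m.
Proof. by rewrite coord psum0 subn0. Qed.

Lemma coord2 m : m x2 = (psum 2 m - psum 1 m)%N.
Proof. by rewrite coord. Qed.

Lemma coordi1 m : m xi1 = (psum (i - 1) m - psum (i - 2) m)%N.
Proof. by rewrite coord /=; congr (psum _ m - _)%N; lia. Qed.

Lemma coordi m : m xi = (psum i m - psum (i - 1) m)%N.
Proof. by rewrite coord /=; congr (psum _ m - _)%N; lia. Qed.

Lemma coordj m : m xj = (psum j m - psum (j - 1) m)%N.
Proof. by rewrite coord /=; congr (psum _ m - _)%N; lia. Qed.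

Lemma lem_ma m : (ma <= m)%MM = (2 <= psum 1 m)%N && (psum (i - 1) m + 2 <= psum i m)%N.
Proof.
rewrite /ma; apply/mnm_lepP/andP => [h|[h1 h2] l].
  have := h x1; have := h xi; rewrite !mnmDE !mnm1E !eqxx coord1 coordi.
  have -> : (x1 == xi) = false by rewrite -val_eqE /=; lia.
  have -> : (xi == x1) = false by rewrite -val_eqE /=; lia.
  by lia.
rewrite !mnmDE !mnm1E; case: eqVneq => [<-|_]; case: eqVneq => [E|_] //.
- by move: E => /(congr1 val) /=; lia.
- by rewrite coord1; lia.
- by rewrite -E coordi; lia.
Qed.

(** For [i = 2] the variable x_(i-1) is x_1 and the generator is x_1^3 x_2, hence the correction
    [(i == 2)]. *)
Lemma lem_mb m : (mb <= m)%MM =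
  [&& (2 + (i == 2) <= psum 1 m)%N, (psum (i - 2) m < psum (i - 1) m)%N &
      (psum (i - 1) m < psum i m)%N].
Proof.
have n1 : (x1 == xi) = false by rewrite -val_eqE /=; lia.
have n2 : (xi1 == xi) = false by rewrite -val_eqE /=; lia.
have n3 : (x1 == xi1) = (i == 2)%N by rewrite -val_eqE /=; lia.
rewrite /mb; apply/mnm_lepP/and3P => [h|[h1 h2 h3] l].
  have := h x1; have := h xi; have := h xi1.
  rewrite !mnmDE !mnm1E !eqxx n1 n2 n3 coord1 coordi coordi1.
  rewrite (eq_sym xi1 x1) n3 (eq_sym xi x1) n1 (eq_sym xi xi1) n2.
  by case: (i == 2)%N; split; lia.
rewrite !mnmDE !mnm1E; have [E|_] := eqVneq xi l.
  by rewrite -E n1 n2 coordi; lia.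
have [E|_] := eqVneq x1 l; last first.
  by have [<-|_] := eqVneq xi1 l; rewrite // coordi1; lia.
by rewrite -E (eq_sym xi1 x1) n3 coord1; lia.
Qed.

Lemma lem_mc m : (mc <= m)%MM = (psum 1 m + 5 <= psum 2 m)%N.
Proof.
rewrite /mc; apply/mnm_lepP/idP => [/(_ x2)|h l].
  by rewrite mulmnE mnm1E eqxx coord2; lia.
by rewrite mulmnE mnm1E; case: eqVneq => // <-; rewrite coord2; lia.
Qed.

Lemma lem_md m : (md <= m)%MM =
  [&& (1 <= psum 1 m)%N, (psum 1 m + 3 <= psum 2 m)%N & (psum (j - 1) m < psum j m)%N].
Proof.
have n1 : (x1 == x2) = false by rewrite -val_eqE.
have n2 : (x1 == xj) = false by rewrite -val_eqE /=; lia.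
have n3 : (x2 == xj) = false by rewrite -val_eqE /=; lia.
rewrite /md; apply/mnm_lepP/and3P => [h|[h1 h2 h3] l].
  have := h x1; have := h x2; have := h xj.
  rewrite !mnmDE !mnm1E !eqxx n1 n2 n3 (eq_sym x2 x1) n1.
  by rewrite (eq_sym xj x1) n2 (eq_sym xj x2) n3 coord1 coord2 coordj; split; lia.
rewrite !mnmDE !mnm1E; have [E|_] := eqVneq x1 l.
  by rewrite -E (eq_sym x2 x1) n1 (eq_sym xj x1) n2 coord1; lia.
have [E|_] := eqVneq x2 l; first by rewrite -E (eq_sym xj x2) n3 coord2; lia.
by have [<-|_] := eqVneq xj l; rewrite // coordj; lia.
Qed.

Lemma psum_ma t : psum t ma = (2 * (0 < t) + 2 * (i - 1 < t))%N.
Proof. by rewrite /ma !psumD !psumU /=; lia. Qed.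

Lemma psum_mb t : psum t mb = (2 * (0 < t) + (i - 2 < t) + (i - 1 < t))%N.
Proof. by rewrite /mb !psumD !psumU /=; lia. Qed.

Lemma psum_mc t : psum t mc = (5 * (1 < t))%N.
Proof. by rewrite /mc !psumD !psumU /=; lia. Qed.

Lemma psum_md t : psum t md = ((0 < t) + 3 * (1 < t) + (j - 1 < t))%N.
Proof. by rewrite /md !psumD !psumU /=; lia. Qed.

Lemma mdeg_ma : mdeg ma = 4%N. Proof. by rewrite /ma !mdegD !mdeg1. Qed.
Lemma mdeg_mb : mdeg mb = 4%N. Proof. by rewrite /mb !mdegD !mdeg1. Qed.
Lemma mdeg_mc : mdeg mc = 5%N. Proof. by rewrite /mc !mdegD !mdeg1. Qed.
Lemma mdeg_md : mdeg md = 5%N. Proof. by rewrite /md !mdegD !mdeg1. Qed.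

(** Monotonicity facts supplied to [lia]. The case [i = 2] is separate: the index [i - 2] is then 0
    and no longer lies above index 1. *)
Lemma psum_relations_i m :
  [/\ ((i - 2 = 0 -> psum (i - 2) m = 0) /\ (i = 2 -> psum (i - 1) m = psum 1 m)
        /\ (i = 2 -> psum i m = psum 2 m))%N,
      ((0 < i - 2)%N -> (psum 1 m <= psum (i - 2) m)%N) /\
        (psum 1 m <= psum (i - 1) m)%N,
      (psum (i - 2) m <= psum (i - 1) m)%N,
      (psum (i - 1) m <= psum i m)%N & (psum i m <= mdeg m)%N].
Proof.
split; [|split|..]; try exact: psum_le_mdeg; try (by move=> ?; apply: leq_psum; lia);
  try (by apply: leq_psum; lia).
by split; [move=> ->; rewrite psum0 | split=> ->].
Qed.

Lemma psum_relations_j m :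
  [/\ (psum 1 m <= psum 2 m)%N, (psum 2 m <= psum (j - 1) m)%N,
      (psum (j - 1) m <= psum j m)%N & (psum j m <= mdeg m)%N].
Proof.
by split; try exact: psum_le_mdeg; apply: leq_psum; lia.
Qed.

Lemma colon_base_b w : base (mb + w)%MM = vars (i - 1) w.
Proof.
rewrite varsE /base mdegD mdeg_mb !(psumD _ mb) !psum_mb.
by have [[h1 _] [h2 h3] h4 h5 h6] := psum_relations_i w; lia.
Qed.

(** As many generators as in [colon_base_b], but one is a square, so adding either monomial
    contributes equally to the Betti numbers. *)
Lemma colon_base_a w : base (ma + w)%MM = vars (i - 2) w || (1 < w xi1)%N.
Proof.
rewrite varsE coordi1 /base mdegD mdeg_ma !(psumD _ ma) !psum_ma.
by have [[h1 _] [h2 h3] h4 h5 h6] := psum_relations_i w; lia.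
Qed.

Lemma base_bE m : base_b m = base m || (mb <= m)%MM.
Proof.
rewrite lem_mb /base /base_b.
by have [[h1 [h1' _]] [h2 h3] h4 h5 h6] := psum_relations_i m; lia.
Qed.

Lemma colon_base_b_a w : base (ma + w)%MM || (mb <= ma + w)%MM = vars (i - 1) w.
Proof.
rewrite -base_bE varsE /base_b mdegD mdeg_ma !(psumD _ ma) !psum_ma.
by have [[h1 [h1' _]] [h2 h3] h4 h5 h6] := psum_relations_i w; lia.
Qed.

(** One variable more than in [colon_base_b_a]: x_i times the second monomial is a multiple of the
    first. This extra variable causes the gap between I and Gin(I). *)
Lemma colon_base_a_b w : base (mb + w)%MM || (ma <= mb + w)%MM = vars i w.
Proof.
rewrite colon_base_b !varsE lem_ma !(psumD _ mb) !psum_mb.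
by have [[h1 [h1' _]] [h2 h3] h4 h5 h6] := psum_relations_i w; lia.
Qed.

Lemma upclosed_base : upclosed base.
Proof.
move=> m m' mm'; rewrite /base.
have := lem_mdeg mm'; have h := fun t => lem_psum t mm'.
by have := h 1%N; have := h (i - 2)%N; have := h (i - 1)%N; lia.
Qed.

(** Each of [pre_gin] and [pre_I] has one exchanged monomial in degree 4 and the multiples of the
    other from degree 5 on. They coincide from degree 5, so the rest of the construction can be
    shared. *)
Definition pre_gin m : bool :=
  (base m || (mb <= m)%MM) ||
  [exists q : 'I_n, (i - 1 <= q)%N && (ma + U_(q) <= m)%MM].
Definition pre_I m : bool :=
  (base m || (ma <= m)%MM) ||
  [exists q : 'I_n, (i <= q)%N && (mb + U_(q) <= m)%MM].

Lemma chain_lem u m q0 :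
  [exists q : 'I_n, (q0 <= q)%N && (u + U_(q) <= m)%MM] ->
  (u <= m)%MM && (mdeg u < mdeg m)%N.
Proof.
move=> /existsP[q /andP[_ um]]; rewrite (lepm_trans _ um) ?lem_addr //=.
by have := lem_mdeg um; rewrite mdegD mdeg1 addn1.
Qed.

Lemma pre_gin_quint m : (5 <= mdeg m)%N -> pre_gin m = quint m.
Proof.
move=> m5; have [[h1 [h1' h1'']] [h2 h3] h4 h5 h6] := psum_relations_i m.
apply/idP/idP.
  rewrite /pre_gin -base_bE => /orP[|/chain_lem/andP[]]; rewrite ?lem_ma /base_b /quint; lia.
move=> qm; rewrite /pre_gin -base_bE; apply/orP.
have [|/negP nb] := boolP (base_b m); [by left|right].
have am : (ma <= m)%MM by rewrite lem_ma; move: nb qm; rewrite /base_b /quint; lia.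
apply: psum_lt_chain => //; move: am nb qm.
by rewrite psum_ma mdeg_ma lem_ma /base_b /quint; lia.
Qed.

Lemma pre_I_quint m : (5 <= mdeg m)%N -> pre_I m = quint m.
Proof.
move=> m5; have [[h1 [h1' h1'']] [h2 h3] h4 h5 h6] := psum_relations_i m.
apply/idP/idP.
  rewrite /pre_I => /orP[/orP[]|/chain_lem/andP[]]; rewrite ?lem_ma ?lem_mb /base /quint; lia.
move=> qm; rewrite /pre_I; apply/orP.
have [|/negP nb] := boolP (base m || (ma <= m)%MM); [by left|right].
have bm : (mb <= m)%MM by rewrite lem_mb; move: nb qm; rewrite lem_ma /base /quint; lia.
apply: psum_lt_chain => //; move: bm nb qm.
by rewrite psum_mb mdeg_mb lem_mb lem_ma /base /quint; lia.
Qed.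

Lemma upclosed_chain (P : pred 'X_{1..n}) u q0 : upclosed P ->
  upclosed (fun m => P m || [exists q : 'I_n, (q0 <= q)%N && (u + U_(q) <= m)%MM]).
Proof.
move=> upP m m' mm' /orP[Pm|/existsP[q /andP[h um]]]; first by rewrite (upP _ _ mm').
by apply/orP; right; apply/existsP; exists q; rewrite h (lepm_trans um mm').
Qed.

Lemma upclosed_add (P : pred 'X_{1..n}) u : upclosed P ->
  upclosed (fun m => P m || (u <= m)%MM).
Proof.
move=> upP m m' mm' /orP[Pm|um]; first by rewrite (upP _ _ mm').
by rewrite (lepm_trans um mm') orbT.
Qed.

Arguments upclosed_chain {P} u q0 upP.
Arguments upclosed_add {P} u upP.

Lemma gen_trunc D (P : pred 'X_{1..n}) m :
    (D <= mdeg m)%N -> P (trunc D m) ->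
  exists v, [/\ (v <= m)%MM, mdeg v = D & P v].
Proof.
move=> Dm Pm; exists (trunc D m); split=> //; first exact: trunc_lem.
by rewrite mdeg_trunc (minn_idPl Dm).
Qed.

Variable K : fieldType.
Local Notation mres := (@mres n K).

(** Left unevaluated, like [low_betti] and [top_betti] below: the same term occurs in all three
    totals and cancels. *)
Definition base_betti k : nat :=
  (\sum_(u : 'X_{1..n < 5} | (mdeg u == 4%N) && base u) 'C(max_index u, k))%N.

Lemma mres_base : mres base 4 base_betti.
Proof.
have := @mres_fill n K pred0 base 4 0 _ (@mres0 n K).
move=> H; apply: eq_mres (H _ _ _ _ _ _ _ _ _) => //.
- by move=> k; rewrite add0n; apply: eq_bigl => u; rewrite andbT.
- exact: upclosed_base.
- move=> m bm _; apply: gen_trunc; first by case/and3P: bm.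
  by move: bm; rewrite /base mdeg_trunc !psum_trunc; lia.
- move=> v u v4 [e h]; have := h 1%N; have := h (i - 2)%N; have := h (i - 1)%N.
  by rewrite /base -e; lia.
Qed.

Lemma mres_pre_gin : mres pre_gin 5 (fun k =>
  base_betti k + 'C(i - 1, k) + \sum_(i - 1 <= q < n) 'C(q, k))%N.
Proof.
have in' : (i - 1 <= n)%N by lia.
have := mres_linear mres_base in' colon_base_b; rewrite mdeg_mb => /(_ isT isT) H.
have := mres_chain H (upclosed_add _ upclosed_base) in' colon_base_b_a.
by rewrite mdeg_ma => /(_ isT).
Qed.

Lemma mres_pre_I : mres pre_I 5 (fun k =>
  base_betti k + 'C(i - 1, k) + \sum_(i <= q < n) 'C(q, k))%N.
Proof.
have in' : (i <= n)%N by lia.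
have := mres_square (q := xi1) mres_base colon_base_a; rewrite mdeg_ma => /(_ isT isT) H.
have := mres_chain H (upclosed_add _ upclosed_base) in' colon_base_a_b.
rewrite mdeg_mb => /(_ isT); apply: eq_mres => // k; congr (_ + 'C(_, k) + _)%N.
by rewrite /=; lia.
Qed.

Definition low_betti k : nat :=
  (\sum_(u : 'X_{1..n < 6} | [&& mdeg u == 5, low u & ~~ quint u]%N) 'C(max_index u, k))%N.
Definition top_betti k : nat :=
  (\sum_(u : 'X_{1..n < 7} | (mdeg u == 6)%N && ~~ low_cd u) 'C(max_index u, k))%N.

Lemma low_trunc D m : (5 <= D)%N -> low (trunc D m) = low m.
Proof. by move=> D5; rewrite /low !psum_trunc; lia. Qed.

Lemma dom_low u v : dom u v -> low u -> low v.
Proof. by move=> [_ h]; rewrite /low; have := h 1%N; have := h 2%N; have := h (j - 1)%N; lia. Qed.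

Lemma lem_low m m' : (m <= m')%MM -> low m -> low m'.
Proof.
move=> mm'; have h := fun t => lem_psum t mm'; rewrite /low.
by have := h 1%N; have := h 2%N; have := h (j - 1)%N; lia.
Qed.

Lemma quint_low m : quint m -> low m.
Proof. by rewrite /quint /low => /andP[->]. Qed.

(** * Degrees at least 5, over any ideal that agrees with [quint] there *)

Section Tail.
Variables (X : pred 'X_{1..n}) (b : nat -> nat).
Hypotheses (upX : upclosed X) (X5 : forall m, (5 <= mdeg m)%N -> X m = quint m).
Hypothesis mresX : mres X 5 b.

Definition add_low m : bool := X m || ((5 <= mdeg m)%N && low m).

Lemma add_low5 m : (5 <= mdeg m)%N -> add_low m = low m.
Proof.
move=> m5; rewrite /add_low m5 X5 //=.
by apply/orP/idP => [[/quint_low|]//|]; right.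
Qed.

Lemma upclosed_add_low : upclosed add_low.
Proof.
move=> m m' mm' /orP[Xm|/andP[m5 lm]]; first by rewrite /add_low (upX mm').
have m5' := leq_trans m5 (lem_mdeg mm').
by rewrite add_low5 // (lem_low mm').
Qed.

Lemma mres_add_low : mres add_low 5 (fun k => b k + low_betti k)%N.
Proof.
have := @mres_fill n K X add_low 5 5 _ mresX upX upclosed_add_low.
move=> H; apply: eq_mres (H _ _ _ _ _ _ _) => [//|k|m Xm|m Xm m5|m|u v u5 [e h]|u v u5 uv|//|//].
- congr (_ + _)%N; apply: eq_bigl => u; case: eqP => //= u5.
  by rewrite add_low5 ?X5 ?u5.
- by rewrite /add_low Xm.
- apply: gen_trunc => //; move: Xm; rewrite !X5 ?mdeg_trunc ?(minn_idPl m5) //.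
  by rewrite /quint !psum_trunc; lia.
- move=> /orP[->//|/andP[m5 lm] _]; apply: gen_trunc => //.
  by rewrite add_low5 ?low_trunc // mdeg_trunc (minn_idPl m5).
- rewrite !X5 -?e ?u5 // /quint.
  by have := h 1%N; have := h (i - 2)%N; have := h i; lia.
- rewrite !add_low5 ?u5 //; first exact: dom_low.
  by case: uv => <-; rewrite u5.
Qed.

(** One variable here against [j - 1] in [colon_low_d]: this asymmetry produces the gap between
    Gin(I) and Lex(I). *)
Lemma colon_low_c w : add_low (mc + w)%MM = vars 1 w.
Proof.
have m5 : (5 <= mdeg (mc + w))%N by rewrite mdegD mdeg_mc leq_addr.
rewrite (add_low5 m5) varsE /low !(psumD _ mc) !psum_mc.
by have [] := psum_relations_j w; lia.
Qed.

Lemma colon_low_d w : add_low (md + w)%MM = vars (j - 1) w.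
Proof.
have m5 : (5 <= mdeg (md + w))%N by rewrite mdegD mdeg_md leq_addr.
rewrite (add_low5 m5) varsE /low !(psumD _ md) !psum_md.
by have [] := psum_relations_j w; lia.
Qed.

Lemma colon_low_c_d w :
  add_low (md + w)%MM || (mc <= md + w)%MM = vars (j - 1) w.
Proof.
rewrite colon_low_d varsE lem_mc !(psumD _ md) !psum_md.
by have [] := psum_relations_j w; lia.
Qed.

Lemma colon_low_d_c w :
  add_low (mc + w)%MM || (md <= mc + w)%MM = vars 1 w.
Proof.
rewrite colon_low_c varsE lem_md !(psumD _ mc) !psum_mc.
by have [] := psum_relations_j w; lia.
Qed.

Lemma mres_top (P : pred 'X_{1..n}) c :
    mres P 6 c -> upclosed P -> (forall m, (6 <= mdeg m)%N -> P m = low_cd m) ->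
  mres (fun m => P m || (6 <= mdeg m)%N) 6 (fun k => c k + top_betti k)%N.
Proof.
move=> mresP upP P6.
have := @mres_fill n K P (fun m => P m || (6 <= mdeg m)%N) 6 6 _ mresP upP.
move=> H; apply: eq_mres (H _ _ _ _ _ _ _ _) =>
  [//|k|m m' mm' /orP[Pm|m6]|m ->//|m Pm m6|m|u v u6 uv|u v u6 [<- _] _|//|//].
- congr (_ + _)%N; apply: eq_bigl => u; case: eqP => //= u6.
  by rewrite u6 orbT P6 ?u6.
- by rewrite (upP _ _ mm' Pm).
- by rewrite (leq_trans m6 (lem_mdeg mm')) orbT.
- apply: gen_trunc => //; move: Pm; rewrite !P6 ?mdeg_trunc ?(minn_idPl m6) //.
  by rewrite /low_cd /low_d !psum_trunc; lia.
- move=> /orP[->//|m6] _; exists (trunc 6 m).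
  by rewrite mdeg_trunc (minn_idPl m6) orbT trunc_lem.
- have [e h] := uv; rewrite !P6 -?e ?u6 // /low_cd /low_d.
  by have := h 1%N; have := h 2%N; have := h j; lia.
- by rewrite u6 orbT.
Qed.

(** The multiples of x_1 x_2^3 x_j are added although m^6 contains them: the degree 6 part becomes
    [low_cd], which is dominance closed and shared with the Lex case, so the final filling costs the
    same. *)
Lemma mres_tail_gin :
  mres (fun m => [|| X m, (5 <= mdeg m)%N && low_c m | (6 <= mdeg m)%N]) 6
    (fun k => b k + low_betti k + 'C(1, k) + \sum_(j - 1 <= q < n) 'C(q, k)
              + top_betti k)%N.
Proof.
have n1 : (1 <= n)%N by lia.
have j1n : (j - 1 <= n)%N by lia.
have := mres_linear mres_add_low n1 colon_low_c; rewrite mdeg_mc => /(_ isT isT) H1.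
have up1 := upclosed_add mc upclosed_add_low.
have := mres_chain H1 up1 j1n colon_low_c_d; rewrite mdeg_md => /(_ isT) H2.
have up2 := upclosed_chain md (j - 1) up1.
apply: eq_mres (mres_top H2 up2 _) => // m; last first.
  move=> m6; have m5 : (5 <= mdeg m)%N by lia.
  rewrite add_low5 //; have [r1 r2 r3 r4] := psum_relations_j m.
  apply/orP/idP => [[/orP[]|/chain_lem/andP[]]|lm].
  - by rewrite /low /low_cd /low_d; lia.
  - by rewrite lem_mc /low_cd; lia.
  - by rewrite lem_md /low_cd /low_d; lia.
  have [|/negP nl] := boolP (low m || (mc <= m)%MM); [by left|right].
  have dm : (md <= m)%MM.
    by rewrite lem_md; move: nl lm; rewrite lem_mc /low /low_cd /low_d; lia.
  apply: psum_lt_chain => //; move: dm nl lm.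
  by rewrite lem_md lem_mc psum_md mdeg_md /low /low_cd /low_d; lia.
have [m6|m6] := leqP 6 (mdeg m); first by rewrite !orbT.
rewrite !orbF; have [r1 r2 r3 r4] := psum_relations_j m.
have -> : [exists q : 'I_n, (j - 1 <= q)%N && (md + U_(q) <= m)%MM] = false.
  by apply/negbTE/negP => /chain_lem/andP[_]; rewrite mdeg_md; lia.
rewrite orbF /add_low /low_c lem_mc /low -orbA; congr (_ || _).
by have := psum_le_mdeg 2 m; lia.
Qed.

Lemma mres_tail_lex :
  mres (fun m => [|| X m, (5 <= mdeg m)%N && low_d m | (6 <= mdeg m)%N]) 6
    (fun k => b k + low_betti k + 'C(j - 1, k) + \sum_(1 <= q < n) 'C(q, k)
              + top_betti k)%N.
Proof.
have n1 : (1 <= n)%N by lia.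
have j1n : (j - 1 <= n)%N by lia.
have := mres_linear mres_add_low j1n colon_low_d; rewrite mdeg_md => /(_ isT isT) H1.
have up1 := upclosed_add md upclosed_add_low.
have := mres_chain H1 up1 n1 colon_low_d_c; rewrite mdeg_mc => /(_ isT) H2.
have up2 := upclosed_chain mc 1 up1.
apply: eq_mres (mres_top H2 up2 _) => // m; last first.
  move=> m6; have m5 : (5 <= mdeg m)%N by lia.
  rewrite add_low5 //; have [r1 r2 r3 r4] := psum_relations_j m.
  apply/orP/idP => [[/orP[]|/chain_lem/andP[]]|lm].
  - by rewrite /low /low_cd /low_d; lia.
  - by rewrite lem_md /low_cd /low_d; lia.
  - by rewrite lem_mc /low_cd /low_d; lia.
  have [|/negP nl] := boolP (low m || (md <= m)%MM); [by left|right].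
  have cm : (mc <= m)%MM.
    by rewrite lem_mc; move: nl lm; rewrite lem_md /low /low_cd /low_d; lia.
  apply: psum_lt_chain => //; move: cm nl lm.
  by rewrite lem_md lem_mc psum_mc mdeg_mc /low /low_cd /low_d; lia.
have [m6|m6] := leqP 6 (mdeg m); first by rewrite !orbT.
rewrite !orbF; have [r1 r2 r3 r4] := psum_relations_j m.
have -> : [exists q : 'I_n, (1 <= q)%N && (mc + U_(q) <= m)%MM] = false.
  by apply/negbTE/negP => /chain_lem/andP[_]; rewrite mdeg_mc; lia.
rewrite orbF /add_low /low_d lem_md /low -orbA; congr (_ || _).
by lia.
Qed.

End Tail.

Lemma upclosed_pre_gin : upclosed pre_gin.
Proof. exact/upclosed_chain/upclosed_add/upclosed_base. Qed.

Lemma upclosed_pre_I : upclosed pre_I.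
Proof. exact/upclosed_chain/upclosed_add/upclosed_base. Qed.

Lemma betti_monGin k : betti (mspan monGin : set {mpoly K[n]}) k =
  (base_betti k + 'C(i - 1, k) + \sum_(i - 1 <= q < n) 'C(q, k) +
   low_betti k + 'C(1, k) + \sum_(j - 1 <= q < n) 'C(q, k) + top_betti k)%N.
Proof.
have H := mres_tail_gin upclosed_pre_gin pre_gin_quint mres_pre_gin.
rewrite (minimal_resolution_betti k (eq_mres (Q := monGin) _ (frefl _) H)) // => m.
rewrite /monGin /core.
have [m5|m4] := leqP 5 (mdeg m).
  rewrite pre_gin_quint //=; have -> : (m == mb) = false.
    by apply/eqP => E; move: m5; rewrite E mdeg_mb.
  by rewrite orbF /quint /base /low_c /low; lia.
have -> /= : (6 <= mdeg m)%N = false by lia.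
rewrite !orbF /pre_gin.
have -> : [exists q : 'I_n, (i - 1 <= q)%N && (ma + U_(q) <= m)%MM] = false.
  by apply/negbTE/negP => /chain_lem/andP[_]; rewrite mdeg_ma; lia.
rewrite orbF; congr (_ || _); apply/idP/eqP => [bm|->]; last exact: lepm_refl.
by apply/esym/lem_mdeg_eq => //; have := lem_mdeg bm; rewrite mdeg_mb; lia.
Qed.

Lemma betti_monI k : betti (mspan monI : set {mpoly K[n]}) k =
  (base_betti k + 'C(i - 1, k) + \sum_(i <= q < n) 'C(q, k) +
   low_betti k + 'C(1, k) + \sum_(j - 1 <= q < n) 'C(q, k) + top_betti k)%N.
Proof.
have H := mres_tail_gin upclosed_pre_I pre_I_quint mres_pre_I.
rewrite (minimal_resolution_betti k (eq_mres (Q := monI) _ (frefl _) H)) // => m.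
rewrite /monI /core.
have [m5|m4] := leqP 5 (mdeg m).
  rewrite pre_I_quint //=; have -> : (m == ma) = false.
    by apply/eqP => E; move: m5; rewrite E mdeg_ma.
  by rewrite orbF /quint /base /low_c /low; lia.
have -> /= : (6 <= mdeg m)%N = false by lia.
rewrite !orbF /pre_I.
have -> : [exists q : 'I_n, (i <= q)%N && (mb + U_(q) <= m)%MM] = false.
  by apply/negbTE/negP => /chain_lem/andP[_]; rewrite mdeg_mb; lia.
rewrite orbF; congr (_ || _); apply/idP/eqP => [bm|->]; last exact: lepm_refl.
by apply/esym/lem_mdeg_eq => //; have := lem_mdeg bm; rewrite mdeg_ma; lia.
Qed.

Lemma betti_monLex k : betti (mspan monLex : set {mpoly K[n]}) k =
  (base_betti k + 'C(i - 1, k) + \sum_(i - 1 <= q < n) 'C(q, k) +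
   low_betti k + 'C(j - 1, k) + \sum_(1 <= q < n) 'C(q, k) + top_betti k)%N.
Proof.
have H := mres_tail_lex upclosed_pre_gin pre_gin_quint mres_pre_gin.
rewrite (minimal_resolution_betti k (eq_mres (Q := monLex) _ (frefl _) H)) // => m.
rewrite /monLex.
have [m5|m4] := leqP 5 (mdeg m).
  by rewrite pre_gin_quint //= /quint /base_b /low_d /low; lia.
have -> /= : (6 <= mdeg m)%N = false by lia.
rewrite !orbF /pre_gin base_bE.
have -> : [exists q : 'I_n, (i - 1 <= q)%N && (ma + U_(q) <= m)%MM] = false.
  by apply/negbTE/negP => /chain_lem/andP[_]; rewrite mdeg_ma; lia.
by rewrite orbF.
Qed.

Lemma betti_I_Gin k :
  betti (mspan monGin : set {mpoly K[n]}) k =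
    (betti (mspan monI : set {mpoly K[n]}) k + 'C(i - 1, k))%N.
Proof.
(* The chain for Gin(I) starts one index earlier; its summand [q = i - 1] is the whole
   difference. *)
rewrite betti_monGin betti_monI (@big_ltn _ _ _ (i - 1)%N); last lia.
have -> : (i - 1).+1 = i by lia.
by lia.
Qed.

Lemma betti_Gin_Lex k :
  betti (mspan monLex : set {mpoly K[n]}) k =
    (betti (mspan monGin : set {mpoly K[n]}) k +
     ('C(j - 1, k) + \sum_(2 <= q < j - 1) 'C(q, k)))%N.
Proof.
(* The summand [q = 1] of the Lex chain cancels the ['C(1, k)] of x_2^5 in Gin(I); the rest is split
   at [j - 1], where the other chain starts. *)
rewrite betti_monLex betti_monGin (@big_ltn _ _ _ 1); last lia.
rewrite (@big_cat_nat _ _ _ (j - 1) 2) /=; [lia | lia | lia].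
Qed.

(** * The generic initial ideal and the lexsegment ideal *)

Hypothesis K0 : [pchar K] =i pred0.
Local Notation A := {mpoly K[n]}.

Lemma dom_core u v : dom u v -> core u -> core v.
Proof.
move=> [e h]; rewrite /core /base /low_c /low -e.
have := h 1%N; have := h 2%N; have := h (i - 2)%N; have := h (i - 1)%N.
by have := h (j - 1)%N; lia.
Qed.

Lemma upclosed_core : upclosed core.
Proof.
move=> m m' mm'; have h := fun t => lem_psum t mm'; have := lem_mdeg mm'.
rewrite /core /base /low_c /low.
have := h 1%N; have := h 2%N; have := h (i - 2)%N; have := h (i - 1)%N.
by have := h (j - 1)%N; lia.
Qed.

Lemma core_ma : core ma = false.
Proof. by rewrite /core /base mdeg_ma !psum_ma; lia. Qed.

Lemma core_mb : core mb = false.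
Proof. by rewrite /core /base mdeg_mb !psum_mb; lia. Qed.

(** A proper multiple of such a [u] has degree at least 5 and is divisible by x_1^2, hence lies in
    [core]. *)
Lemma core_above m u : mdeg u = 4%N -> (1 < psum 1 u)%N -> (u <= m)%MM ->
  core m || (m == u).
Proof.
move=> u4 u1 um; have := lem_mdeg um; rewrite u4 leq_eqVlt => /orP[/eqP m4|m5].
  by rewrite (lem_mdeg_eq um) ?eqxx ?orbT // u4.
have := lem_psum 1 um; rewrite /core /low_c /low m5; lia.
Qed.

Lemma upclosed_monI : upclosed monI.
Proof.
move=> m m' mm' /orP[/(upclosed_core mm') cm'|/eqP mE]; first by rewrite /monI cm'.
by apply: core_above; rewrite ?mdeg_ma ?psum_ma -?mE.
Qed.

Lemma upclosed_monGin : upclosed monGin.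
Proof.
move=> m m' mm' /orP[/(upclosed_core mm') cm'|/eqP mE]; first by rewrite /monGin cm'.
by apply: core_above; rewrite ?mdeg_mb ?psum_mb -?mE //; lia.
Qed.

Lemma ma_neq_mb : ma != mb.
Proof.
apply/eqP => /(congr1 (fun m => psum (i - 1) m)); rewrite psum_ma psum_mb; lia.
Qed.

Lemma ma_lt_mb : revlex_lt ma mb.
Proof.
apply: dom_revlex ma_neq_mb; split=> [|t]; first by rewrite mdeg_ma mdeg_mb.
by rewrite psum_ma psum_mb; lia.
Qed.

Section Upper.
Variable U : 'M[K]_n.
Hypotheses (Uu : U \in unitmx) (uU : upper U) (Unz : U xi1 xi != 0).

Lemma two_neq0 : 2%:R != 0 :> K.
Proof. by have /pcharf0P -> := K0. Qed.

Lemma lin_subst_ma : exists c d (g : A),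
  [/\ lin_subst U 'X_[ma] = c *: 'X_[ma] + d *: 'X_[mb] + g, mspan core g,
      2%:R * U xi1 xi * c = U xi xi * d & d != 0].
Proof.
pose y : A := \sum_(l < n | (l != xi) && (l != xi1)) U l xi *: 'X_l.
have yP m : m \in msupp y -> exists2 l : 'I_n, (l < i - 2)%N & m = U_(l)%MM.
  move=> /msupp_sum_le/flatten_mapP[l]; rewrite mem_filter => /andP[/andP[l1 l2] _].
  rewrite mcoeff_msupp mcoeffZ mcoeffX => H; exists l; last first.
    by apply/eqP; move: H; case: (eqVneq U_(l)%MM m) => [//|_]; rewrite mulr0 eqxx.
  have : ~~ (xi < l)%N by apply: contraNN H => il; rewrite uU ?mul0r.
  by move: l1 l2; rewrite -!val_eqE /=; lia.
have E1 : lin_subst U 'X_x1 = (U x1 x1)%:MP * 'X_x1.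
  rewrite lin_substU (bigD1 x1) //= big1 ?addr0 ?mul_mpolyC // => l lx.
  rewrite uU ?scale0r //; move: lx; rewrite -val_eqE /=; lia.
have xx : xi1 != xi by rewrite -val_eqE /=; lia.
have E2 : lin_subst U 'X_xi = (U xi xi)%:MP * 'X_xi + (U xi1 xi)%:MP * 'X_xi1 + y.
  by rewrite lin_substU (bigD1 xi) //= (bigD1 xi1) //= !mul_mpolyC addrA.
(* With a, b the coefficients of x_i, x_(i-1), the square of a x_i + b x_(i-1) + y is a^2 x_i^2 +
   2ab x_(i-1) x_i + b^2 x_(i-1)^2 + y z. After multiplication by x_1^2 the last two terms fall into
   [core]. *)
pose z : A := 2%:R * (U xi xi)%:MP * 'X_xi + 2%:R * (U xi1 xi)%:MP * 'X_xi1 + y.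
pose g : A := (((U x1 x1 * U xi1 xi) ^+ 2) *: 'X_[U_(xi1) *+ 2] +
               ((U x1 x1) ^+ 2) *: (y * z)) * 'X_[U_(x1) *+ 2].
exists ((U x1 x1 * U xi xi) ^+ 2),
  (2%:R * (U x1 x1) ^+ 2 * U xi xi * U xi1 xi), g; split.
- have -> : 'X_[ma] = 'X_x1 ^+ 2 * 'X_xi ^+ 2 :> A by rewrite mpolyXD !mpolyXn.
  have -> : 'X_[mb] = 'X_x1 ^+ 2 * 'X_xi1 * 'X_xi :> A by rewrite 2!mpolyXD mpolyXn.
  rewrite /g -!mpolyXn lin_substM !lin_substXn E1 E2 /z.
  rewrite -!mul_mpolyC !expr2 !mpolyCM mpolyC_nat.
  by ring.
- apply/(mspan_colon core (U_(x1) *+ 2)%MM).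
  apply: mspan_lin.
    apply: mspanX; rewrite /core /base !mdegD !psumD !mdeg1 !psumU /=.
    lia.
  move=> m /msuppZ_le /msuppM_le /allpairsP[[m1 m2] /= [/yP[l lt ->] m2z ->]].
  have m2d : mdeg m2 = 1%N.
    move: m2z; rewrite /z => /msuppD_le; rewrite mem_cat => /orP[/msuppD_le|/yP[l' _ ->]];
      last by rewrite mdeg1.
    by rewrite -!mpolyC_nat -!mpolyCM !mul_mpolyC mem_cat => /orP[] /msuppZ_le;
      rewrite msuppX inE => /eqP ->; rewrite mdeg1.
  rewrite /core /base !mdegD !psumD !mdeg1 !psumU m2d /=.
  lia.
- by ring.
by rewrite !mulf_neq0 ?two_neq0 ?expf_neq0 ?(upper_diag _ Uu uU).
Qed.

Lemma lin_subst_core (h : 'M[K]_n) (f : A) : upper h -> mspan core f -> mspan core (lin_subst h f).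
Proof.
move=> uh; move: f; apply: mspan_ind => [|c f g Hf Hg|m cm].
- by rewrite lin_subst0 => m; rewrite msupp0.
- by rewrite lin_substD lin_substZ; apply: mspan_lin.
by move=> u /(upper_supp uh) mu; apply: dom_core cm.
Qed.

(** Modulo [core] the ideal is a line, so the coefficients of the image at [ma] and [mb] are a
    multiple of [(c, d)]. The relation is the linear equation of that line. *)
Lemma lin_subst_monI (f : A) : mspan monI f ->
  (forall m, m \in msupp (lin_subst U f) -> [|| core m, m == ma | m == mb]) /\
  2%:R * U xi1 xi * (lin_subst U f)@_ma = U xi xi * (lin_subst U f)@_mb.
Proof.
have [c [d [g [E gc cd d0]]]] := lin_subst_ma.
have coreP (h : A) : mspan core h -> h@_ma = 0 /\ h@_mb = 0.
  move=> hc; split; apply: memN_msupp_eq0; apply/negP => /hc.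
    by rewrite core_ma.
  by rewrite core_mb.
move: f; apply: mspan_ind => [|e f h [fS fE] [hS hE]|m].
- by rewrite lin_subst0; split=> [m|]; [rewrite msupp0 | rewrite 2!mcoeff0 2!mulr0].
- rewrite lin_substD lin_substZ; split=> [m|].
    by move=> /msuppD_le; rewrite mem_cat => /orP[/msuppZ_le|]; [apply: fS|apply: hS].
  have lin u : (e *: lin_subst U f + lin_subst U h)@_u =
      e * (lin_subst U f)@_u + (lin_subst U h)@_u by rewrite mcoeffD mcoeffZ.
  move: fE hE; rewrite (lin ma) (lin mb).
  move: (_@_ma) (_@_mb) (_@_ma) (_@_mb) => f1 f2 h1 h2 fE hE.
  by rewrite [LHS]mulrDr [RHS]mulrDr hE mulrCA fE mulrCA.
move=> /orP[cm|/eqP ->].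
  have Xc := lin_subst_core uU (@mspanX n K core m cm).
  split=> [u /Xc ->//|]; have [-> ->] := coreP _ Xc.
  by rewrite !mulr0.
rewrite E; split=> [u|].
  move=> /msuppD_le; rewrite mem_cat => /orP[/msuppD_le|/gc -> //].
  by rewrite mem_cat => /orP[] /msuppZ_le; rewrite msuppX inE => ->; rewrite ?orbT.
have [g1 g2] := coreP _ gc.
rewrite !mcoeffD !mcoeffZ !mcoeffX g1 g2 !eqxx.
by rewrite [mb == ma]eq_sym (negbTE ma_neq_mb) !mulr0 !mulr1 !addr0 add0r.
Qed.

Lemma leads_monI :
  leads (lin_subst U @` (mspan monI : set A))%classic =
  [set m | monGin m]%classic.
Proof.
have [c [d [g [E gc cd d0]]]] := lin_subst_ma.
(* The inverse of [U] is upper triangular too, so the span of [core] equals its own image. *)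
have inI (f : A) : mspan core f -> exists2 f', mspan monI f' & lin_subst U f' = f.
  move=> fc; exists (lin_subst (invmx U) f); last by rewrite lin_substVK.
  by move=> m /(lin_subst_core (invmx_upper Uu uU) fc) cm; rewrite /monI cm.
apply/seteqP; split=> m /=.
  case=> _ [f fI <-] [mf mP].
  have [fS fE] := lin_subst_monI fI.
  have /or3P[cm|/eqP mE|/eqP ->] := fS m mf; rewrite /monGin ?eqxx ?orbT ?cm //.
  (* A polynomial led by [ma] has no [mb] term, since [mb] is larger; the relation and [Unz] then
     annihilate the coefficient of [ma] as well. *)
  move: fE; rewrite [X in _ = _ * X]memN_msupp_eq0 ?mulr0 => [/eqP|]; last first.
    apply/negP => /mP; rewrite eq_sym mE ma_neq_mb => /(_ isT).
    by move=> /(revlex_lt_trans ma_lt_mb); rewrite (negbTE (revlex_lt_irr _)).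
  rewrite mulf_eq0 mulf_eq0 (negbTE two_neq0) (negbTE Unz) /= -mE.
  by rewrite mcoeff_eq0 mf.
move=> /orP[cm|/eqP ->].
  have [f fI fE] := inI _ (@mspanX n K core m cm); exists 'X_[m]; first by exists f.
  by split=> [|m']; rewrite msuppX inE // => ->.
(* Removing from the image of [ma] its part in [core] leaves a binomial of the image, led by [mb]
   because [d] is nonzero. *)
have [f fI fE] := inI _ gc.
exists (c *: 'X_[ma] + d *: 'X_[mb]).
  exists (-1 *: f + 'X_[ma]).
    by apply: mspan_lin => //; apply: mspanX; rewrite /monI eqxx orbT.
  by rewrite lin_substD lin_substZ fE E scaleN1r addrC addrK.
split=> [|m'].
  rewrite mcoeff_msupp mcoeffD !mcoeffZ !mcoeffX (negbTE ma_neq_mb) eqxx.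
  by rewrite mulr0 add0r mulr1.
move=> /msuppD_le; rewrite mem_cat => /orP[] /msuppZ_le; rewrite msuppX inE => /eqP ->.
  by move=> _; apply: ma_lt_mb.
by rewrite eqxx.
Qed.

End Upper.

Lemma Gin_monI : Gin (mspan monI : set A) = mspan monGin.
Proof.
apply: Gin_eq => //; apply: (@is_gin_leads _ _ _ _ xi1 xi upclosed_monGin).
  by rewrite /=; lia.
by move=> U Uu uU Unz; apply: leads_monI.
Qed.

Lemma monomial_ideal_monI : monomial_ideal (mspan monI : set A).
Proof.
by exists [set m | monI m]%classic; rewrite ideal_gen_monomials //; apply: upclosed_monI.
Qed.

Lemma monLex_lex m u : mdeg m = mdeg u -> (m < u)%O -> monLex m -> monLex u.
Proof.
move=> E /(lt_psum E)[k eqk ltk].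
(* Past the first difference the partial sums of [u] exceed [psum k.+1 m]. So each threshold met by
   [m] is met by [u], either by equality or because an earlier sum of [m] was at most one short of
   it. *)
have gt t : (k < t)%N -> (psum k.+1 m < psum t u)%N.
  by move=> kt; apply: leq_trans ltk _; apply: leq_psum.
have cmp t : psum t m = psum t u \/ (k < t)%N /\ (psum k.+1 m < psum t u)%N.
  by case: (leqP t k) => kt; [left; apply: eqk | right; split=> //; apply: gt].
have le t : (t <= k.+1)%N -> (psum t m <= psum k.+1 m)%N by apply: leq_psum.
have b_lex : mdeg m = 4%N -> base_b m -> base_b u.
  move=> m4; rewrite /base_b -E m4 => /and3P[_ m1 mi].
  have u1 : (2 <= psum 1 u)%N.
    by have [<-//|[k1]] := cmp 1%N; have := le 1%N isT; lia.
  rewrite u1 /=; case/orP: mi => [mi|/andP[mi mi']].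
    by have [<-|[_]] := cmp (i - 2)%N; [rewrite mi|have := le 1%N isT; lia].
  have [k2|k2] := ltnP k (i - 2).
    by have := gt _ k2; have := le 1%N isT; lia.
  have [k1|k1] := ltnP k (i - 1); last first.
    rewrite -(eqk _ k1) mi; have [<-|[ki]] := cmp i; first by rewrite mi' orbT.
    have ek : k.+1 = i by lia.
    by rewrite ek; lia.
  have ek : k.+1 = (i - 1)%N by lia.
  by move: (gt _ k1) (gt i); rewrite ek; lia.
have d_lex : low_d m -> low_d u.
  rewrite /low_d => /orP[m1|/and3P[m1 m2 mj]].
    by apply/orP; left; have [<-//|[k1]] := cmp 1%N; have := le 1%N isT; lia.
  have [k1|k1] := ltnP k 1; first by have := gt _ k1; have := le 1%N isT; lia.
  rewrite -(eqk _ k1) m1 /=; apply/orP; right.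
  have [k2|k2] := ltnP k 2; last first.
    by rewrite -(eqk _ k2) m2; have [<-//|[_]] := cmp j; have := le 2%N (leqW k2); lia.
  have ek : k = 1%N by lia.
  by move: (gt 2%N) (gt j); rewrite ek; lia.
rewrite /monLex -E => /or3P[bm|/andP[m5 /d_lex ->]|->]; rewrite ?m5 ?orbT //.
have [m4|m4] := eqVneq (mdeg m) 4%N; first by rewrite b_lex.
have m5 : (5 <= mdeg m)%N by case/and3P: bm; lia.
rewrite m5 d_lex ?orbT //; apply/orP; left; by case/and3P: bm.
Qed.

(** I is compared with Lex(I) directly, without Gin(I): degree 4 exchanges [ma] for [mb], degree 5
    exchanges [mc] for [md], and all other degrees agree. *)
Lemma count_monI d : count_deg monI d = count_deg monLex d.
Proof.
have eqm v m : mdeg m = mdeg v -> m != v -> ~~ (v <= m)%MM.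
  by move=> E; apply: contra => /lem_mdeg_eq ->.
have [d3|] := leqP d 3.
  apply: eq_count_deg => m md3; rewrite /monI /core /base /monLex /base_b md3.
  rewrite (_ : (m == ma) = false); last first.
    by apply/eqP => E; move: md3; rewrite E mdeg_ma; lia.
  lia.
rewrite leq_eqVlt => /orP[/eqP <-|].
  apply: (count_deg_swap mdeg_ma mdeg_mb).
  - move=> m m4; rewrite /monI /core /monLex base_bE m4 /= !orbF.
    by move=> /orP[->//|->].
  - move=> m m4; rewrite /monI /core /monLex base_bE m4 /= !orbF.
    move=> /orP[->//|mbm ne].
    by have := eqm mb m; rewrite mdeg_mb mbm m4 => /(_ erefl ne).
  - by rewrite /monI eqxx orbT.
  - by rewrite /monLex mdeg_ma /base_b !psum_ma; lia.
  - by rewrite /monLex base_bE lepm_refl orbT.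
  rewrite /monI core_mb eq_sym; exact: ma_neq_mb.
rewrite leq_eqVlt => /orP[/eqP <-|d6]; last first.
  apply: eq_count_deg => m md6.
  by rewrite /monI /core /monLex md6 d6 !orbT.
have ne5 m : mdeg m = 5%N -> (m == ma) = false.
  by move=> m5; apply/eqP => E; move: m5; rewrite E mdeg_ma.
apply: (count_deg_swap mdeg_mc mdeg_md).
- move=> m m5; rewrite /monI /core /monLex m5 /= !orbF ne5 // orbF => H ne.
  have := eqm mc m; rewrite mdeg_mc m5 => /(_ erefl ne).
  have [r1 r2 r3 r4] := psum_relations_j m.
  by move: H; rewrite lem_mc /base /base_b /low_c /low_d /low; lia.
- move=> m m5; rewrite /monI /core /monLex m5 /= !orbF ne5 // orbF => H ne.
  have := eqm md m; rewrite mdeg_md m5 => /(_ erefl ne).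
  have [r1 r2 r3 r4] := psum_relations_j m.
  by move: H; rewrite lem_md /base /base_b /low_c /low_d /low; lia.
- by rewrite /monI /core mdeg_mc /low_c /low !psum_mc; lia.
- by rewrite /monLex mdeg_mc /base_b /low_d !psum_mc; lia.
- by rewrite /monLex mdeg_md /base_b /low_d !psum_md; lia.
rewrite /monI ne5 ?mdeg_md // /core mdeg_md /base /low_c /low !psum_md; lia.
Qed.

Lemma Lex_monI : Lex (mspan monI : set A) = mspan monLex.
Proof.
apply: Lex_mspan => [d|m u]; first by rewrite hilb_mspan count_monI.
exact: monLex_lex.
Qed.

End Construction.

Theorem theorem0p2 (K : fieldType) (hK : ([pchar K]%R =i pred0)) (n i j : nat)
    (hi : (2 <= i <= n)%N) (hj : (3 <= j <= n)%N) :
  exists I : set {mpoly K[n]},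
    monomial_ideal I /\
    (forall k : nat, (k < i)%N -> (betti I k < betti (Gin I) k)%N) /\
    betti I i = betti (Gin I) i /\
    (forall l : nat, (l < j)%N -> (betti (Gin I) l < betti (Lex I) l)%N) /\
    betti (Gin I) j = betti (Lex I) j.
Proof.
have gin := @betti_I_Gin n i j hi hj K; have lex := @betti_Gin_Lex n i j hi hj K.
exists (mspan (monI hi hj)); rewrite (Gin_monI hi hj hK) Lex_monI.
split; first exact: monomial_ideal_monI.
split=> [k ki|].
  by rewrite gin -[ltnLHS]addn0 ltn_add2l bin_gt0; lia.
split; first by rewrite gin bin_small; [rewrite addn0 | lia].
split=> [l lj|].
  rewrite [ltnRHS]lex -[ltnLHS]addn0 ltn_add2l addn_gt0 bin_gt0.
  by apply/orP; left; lia.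
rewrite [RHS]lex; suff -> : ('C(j - 1, j) + \sum_(2 <= q < j - 1) 'C(q, j) = 0)%N.
  by rewrite addn0.
rewrite bin_small; last lia.
rewrite add0n big_nat_cond big1 // => q /andP[/andP[_ qj] _].
by apply: bin_small; lia.
Qed.
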